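(* The conjugacy class, in the group $\mathrm{Sp}(2n,\mathbb R)$, of a matrix $A\in\mathrm{Sp}(2n,\mathbb R)$ is determined by the following data: - the eigenvalues of $A$, which arise in quadruples $[\lambda]=\{\lambda,\lambda^{-1},\overline\lambda,\overline\lambda^{-1}\}$; - the dimension $\dim\ker(A-\lambda\,\mathrm{Id})^r$ for each $r\ge1$, for one eigenvalue $\lambda$ in each class $[\lambda]$; - for $\lambda=\pm1$ (when it is an eigenvalue), the rank and the signature of the symmetric bilinear form $\hat Q^\lambda_{2k}$ for each $k\ge1$; and, for one eigenvalue $\lambda$ chosen in each class $[\lambda]\subset S^1\setminus\{\pm1\}$, the rank and the signature of the Hermitian form $\hat Q^\lambda_m$ for each $m\ge1$. That is, two matrices in $\mathrm{Sp}(2n,\mathbb R)$ for which all these data coincide (with the same choice of representative $\lambda$ in each class $[\lambda]$) are conjugate in $\mathrm{Sp}(2n,\mathbb R)$.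
   Context: $\mathrm{Sp}(2n,\mathbb R)=\{A\in \mathrm{Mat}(2n\times2n,\mathbb R)\mid A^\tau\Omega_0A=\Omega_0\}$ with $\Omega_0=\begin{pmatrix}0&\mathrm{Id}\\-\mathrm{Id}&0\end{pmatrix}$; $\Omega$ is the bilinear form on $\mathbb R^{2n}$ with matrix $\Omega_0$, extended $\mathbb C$-bilinearly to $\mathbb C^{2n}$. For $\lambda\in\{\pm1\}$ and $k\ge1$, $\hat Q^\lambda_{2k}$ is the real symmetric bilinear form on $\ker(A-\lambda\,\mathrm{Id})^{2k}\subset\mathbb R^{2n}$ given by $$\hat Q^\lambda_{2k}(v,w)=\lambda\,\Omega\bigl((A-\lambda\,\mathrm{Id})^kv,(A-\lambda\,\mathrm{Id})^{k-1}w\bigr).$$ For $\lambda\in S^1\setminus\{\pm1\}$ and $m\ge1$, $\hat Q^\lambda_m$ is the Hermitian form on $\ker(A-\lambda\,\mathrm{Id})^m\subset\mathbb C^{2n}$ given by $$\hat Q^\lambda_m(v,w)=\begin{cases}\frac1\lambda\,\Omega\bigl((A-\lambda\,\mathrm{Id})^kv,(A-\overline\lambda\,\mathrm{Id})^{k-1}\overline w\bigr)&\text{if }m=2k,\\ i\,\Omega\bigl((A-\lambda\,\mathrm{Id})^kv,(A-\overline\lambda\,\mathrm{Id})^{k}\overline w\bigr)&\text{if }m=2k+1.\end{cases}$$ The signature is the number of positive minus the number of negative eigenvalues of a Gram matrix; together with the rank it determines both numbers. For $\lambda\ne\pm1$, kernels are taken in $\mathbb C^{2n}$. *)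

(* Defs.v *)
From mathcomp Require Import all_boot all_order all_algebra.
From mathcomp Require Import reals.
From mathcomp Require Export complex.

Set Implicit Arguments.
Unset Strict Implicit.
Unset Printing Implicit Defensive.

Import Order.TTheory GRing.Theory Num.Theory.

Local Open Scope ring_scope.

Definition Omega0 (K : pzRingType) (n : nat) : 'M[K]_(n + n) :=
  block_mx 0 1%:M (- 1%:M) 0.

(* Over K = R[i] this is the C-bilinear extension of the real form.  Vectors are
   columns, on which matrices act on the left. *)
Definition Omega (K : pzRingType) (n : nat) (v w : 'cV[K]_(n + n)) : K :=
  (v^T *m Omega0 K n *m w) 0 0.

Definition symplectic (K : pzRingType) (n : nat) (A : 'M[K]_(n + n)) : bool :=
  A^T *m Omega0 K n *m A == Omega0 K n.

Definition complexify (R : realType) (p q : nat) (A : 'M[R]_(p, q)) :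
    'M[R[i]]_(p, q) :=
  map_mx (real_complex R) A.

Definition eigen_class (R : realType) (l : R[i]) : seq R[i] :=
  [:: l; l^-1; conjc l; (conjc l)^-1].

(* [kermx] is a row kernel: the transposed rows of [colker M r] span
   { v | M ^ r v = 0 }, and \rank (colker M r) is the dimension of that space. *)
Definition colker (K : fieldType) (d : nat) (M : 'M[K]_d) (r : nat) : 'M[K]_d :=
  kermx (M ^+ r)^T.

Lemma colkerP (K : fieldType) (d : nat) (M : 'M[K]_d) (r : nat) (v : 'cV[K]_d) :
  (v^T <= colker M r)%MS = (M ^+ r *m v == 0).
Proof.
by rewrite sub_kermx -trmx_mul -trmx0 (inj_eq (@trmx_inj _ _ _)).
Qed.

(* A form of index m lives on ker (M ^ m); its Gram matrix is taken in the
   basis of that kernel provided by [row_base]. *)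
Definition gram (K : fieldType) (d : nat) (M : 'M[K]_d) (m : nat)
    (Q : 'cV[K]_d -> 'cV[K]_d -> K) : 'M[K]_(\rank (colker M m)) :=
  \matrix_(i, j) Q (row i (row_base (colker M m)))^T
                   (row j (row_base (colker M m)))^T.

(* The form of index 2k at e = 1 or e = -1, for k >= 1. *)
Definition Qreal (R : realType) (n : nat) (A : 'M[R]_(n + n)) (e : R) (k : nat)
    (v w : 'cV[R]_(n + n)) : R :=
  e * Omega ((A - e%:M) ^+ k *m v) ((A - e%:M) ^+ k.-1 *m w).

(* The form of index m >= 1, with m./2 = k for m = 2k and for m = 2k+1. *)
Definition Qherm (R : realType) (n : nat) (A : 'M[R]_(n + n)) (l : R[i])
    (m : nat) (v w : 'cV[R[i]]_(n + n)) : R[i] :=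
  let N := complexify A - l%:M in
  let N' := complexify A - (conjc l)%:M in
  let w' := map_mx conjc w in
  let k := m./2 in
  if odd m then 'i%C * Omega (N ^+ k *m v) (N' ^+ k *m w')
  else l^-1 * Omega (N ^+ k *m v) (N' ^+ k.-1 *m w').

Definition gram_real (R : realType) (n : nat) (A : 'M[R]_(n + n)) (e : R)
    (k : nat) :=
  gram (A - e%:M) (2 * k) (Qreal A e k).

Definition gram_herm (R : realType) (n : nat) (A : 'M[R]_(n + n)) (l : R[i])
    (m : nat) :=
  gram (complexify A - l%:M) m (Qherm A l m).

(* All eigenvalues, repeated according to algebraic multiplicity. *)
Definition eigenvalues (R : realType) (d : nat) (G : 'M[R[i]]_d) : seq R[i] :=
  sval (closed_field_poly_normal (char_poly G)).

(* In R[i], 0 < z means that z is real and positive; the eigenvalues of a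
   Hermitian matrix are all real. *)
Definition signature (R : realType) (d : nat) (G : 'M[R[i]]_d) : int :=
  (count (fun z => 0 < z) (eigenvalues G))%:Z
  - (count (fun z => z < 0) (eigenvalues G))%:Z.

(* [rep] selects one element in the class of each eigenvalue of A; its values
   elsewhere are irrelevant.  [eigenvalue] refers to row vectors, but row and
   column eigenvectors of a square matrix have the same eigenvalues. *)
Definition class_representatives (R : realType) (n : nat) (A : 'M[R]_(n + n))
    (rep : R[i] -> R[i]) : Prop :=
  forall l : R[i], eigenvalue (complexify A) l ->
    rep l \in eigen_class l /\
    (forall mu : R[i], mu \in eigen_class l -> rep mu = rep l).

(* Main.v *)
(* Write B = A^T, acting on row vectors, so that B J B^T = J with J = Omega0.
   Let X be a linear map intertwining B and B', let X^dag = J' X^* J^-1 be its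
   adjoint, and H = X X^dag. On a part of the space where H has a square root
   that is a polynomial in H, the polar part H^(-1/2) X of X is an isometry
   that intertwines B and B'. So as soon as tr (X X^dag) > 0, nonzero isometric
   invariant summands split off on both sides; ranks and signatures are
   additive, and one concludes by induction on the dimension.

   To find X, let a lie in the kernel of (B - 1/conj l)^m and b in the kernel of
   (B' - l)^m; then
     X = sum_j (B - l)^j (J a^* ) b (B' - l)^(m-1-j)
   intertwines B and B'. For |l| = 1 one gets tr (X X^dag) = m Q_m(a) Q'_m(b), so
   it suffices that Q_m and Q'_m take a common sign, which equality of the
   signatures ensures when m is the largest size of a Jordan block at l (for
   l = 1 or -1 and m odd, Q_m changes sign under conjugation). For |l| <> 1 such
   maps at l and at 1/conj l are isotropic for tr (X Y^dag) but pair nontrivially,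
   so a combination of the two has positive trace.
   Finally the real or the imaginary part of such an X has positive trace. *)

Require Import Defs.
From mathcomp Require Import all_boot all_order all_algebra.
From mathcomp Require Import reals.
From mathcomp Require Import ring lra zify.

Set Implicit Arguments.
Unset Strict Implicit.
Unset Printing Implicit Defensive.

Import Order.TTheory GRing.Theory Num.Theory.

Local Open Scope ring_scope.
Local Open Scope sesquilinear_scope.

(** * Inertia of Hermitian matrices *)

Lemma trC_mul (C : numClosedFieldType) m n p (A : 'M[C]_(m, n)) (B : 'M[C]_(n, p)) :
  (A *m B)^t* = B^t* *m A^t*.
Proof. by rewrite trmx_mul map_mxM. Qed.

Lemma char_poly_similar (F : fieldType) n (P A : 'M[F]_n) :
  P \in unitmx -> char_poly (invmx P *m A *m P) = char_poly A.
Proof.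
move=> Pu; rewrite /char_poly.
have -> : char_poly_mx (invmx P *m A *m P) =
   map_mx polyC (invmx P) *m char_poly_mx A *m map_mx polyC P.
  rewrite /char_poly_mx mulmxBr mulmxBl -!map_mxM scalar_mxC.
  by rewrite -[X in _ = X - _]mulmxA -map_mxM mulVmx // map_mx1 mulmx1.
by rewrite !det_mulmx mulrC mulrA -det_mulmx -map_mxM mulmxV // map_mx1 det1 mul1r.
Qed.

Definition qf (C : numClosedFieldType) d (G : 'M[C]_d) (v : 'rV[C]_d) : C :=
  (v *m G *m v^t*) 0 0.

Section Inertia.
Variable R : realType.
Let C : numClosedFieldType := R[i].

Lemma char_poly_eigenvalues d (G : 'M[C]_d) :
  char_poly G = \prod_(z <- eigenvalues G) ('X - z%:P).
Proof.
rewrite /eigenvalues; case: closed_field_poly_normal => s /= e.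
by rewrite {1}e (monicP (char_poly_monic G)) scale1r.
Qed.

Definition npos d (G : 'M[C]_d) := count (fun z => 0 < z) (eigenvalues G).
Definition nneg d (G : 'M[C]_d) := count (fun z => z < 0) (eigenvalues G).

Lemma perm_eigenvalues_diag d (G P : 'M[C]_d) (D : 'rV[C]_d) :
  P \in unitmx -> G = invmx P *m diag_mx D *m P ->
  perm_eq (eigenvalues G) [seq D 0 i | i <- enum 'I_d].
Proof.
move=> Pu ->; apply: prod_XsubC_eq; rewrite -char_poly_eigenvalues.
rewrite char_poly_similar // char_poly_trig ?diag_mx_is_trig //.
rewrite big_map big_enum /=; apply: eq_bigr => i _.
by rewrite mxE eqxx mulr1n.
Qed.

Lemma hermitian_diagE d (G : 'M[C]_d) : G^t* = G ->
  exists P : 'M[C]_d, exists D : 'rV[C]_d,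
  [/\ P \in unitmx, G = invmx P *m diag_mx D *m P, P *m G *m P^t* = diag_mx D
    & forall i, D 0 i \is Num.real].
Proof.
move=> hG; have hs : G \is hermsymmx.
  by apply/is_hermitianmxP; rewrite expr0 scale1r.
have e := orthomx_spectralP (hermitian_normalmx hs).
exists (spectralmx G), (spectral_diag G); split=> //.
- exact: spectral_unit.
- rewrite {2}e -invmx_unitary ?spectral_unitarymx // !mulmxA mulmxV ?spectral_unit //.
  by rewrite mul1mx -mulmxA mulmxV ?spectral_unit // mulmx1.
- by move=> i; have /mxOverP := hermitian_spectral_diag_real hs; apply.
Qed.

(** Coordinate projection onto the indices in [S]. Multiplied on the right by a diagonalizing matrix
    [P], it has as row space the span of the eigenvectors selected by [S]. *)
Definition indic d (S : pred 'I_d) : 'M[C]_d := diag_mx (\row_i (S i)%:R).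

Lemma mxrank_indic_le d (S : pred 'I_d) : (\rank (indic S) <= #|S|)%N.
Proof.
have -> : indic S = \sum_(i | S i) delta_mx i i.
  apply/matrixP => i j; rewrite !mxE summxE.
  under eq_bigr do rewrite mxE.
  case: (boolP (i == j)) => [/eqP <-|nij]; last first.
    by rewrite big1 // => k _; case: eqP => //= <-; rewrite eq_sym (negbTE nij).
  rewrite mulr1n; case: (boolP (S i)) => Si.
    rewrite (bigD1 i) //= eqxx big1 ?addr0 // => k /andP[_ /negbTE].
    by rewrite eq_sym => ->.
  by rewrite big1 // => k Sk; case: eqP => // ik; rewrite ik Sk in Si.
rewrite -sum1_card; elim/big_rec2: _ => [|i k M _ IH]; first by rewrite mxrank0.
by apply: leq_trans (mxrank_add _ _) _; rewrite mxrank_delta leq_add2l.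
Qed.

(** The projections onto [S] and onto its complement add up to the identity, so both upper bounds on
    their ranks are attained. *)
Lemma mxrank_indic d (S : pred 'I_d) : \rank (indic S) = #|S|.
Proof.
apply/eqP; rewrite eqn_leq mxrank_indic_le /=.
have hc : (d <= \rank (indic S) + \rank (indic (predC S)))%N.
  rewrite -{1}[d](mxrank1 C); apply: leq_trans (mxrank_add _ _).
  rewrite /indic -linearD /=; apply: mxrankS; set D := _ + _.
  suff -> : D = const_mx 1 by rewrite diag_const_mx.
  by apply/rowP => i; rewrite !mxE /=; case: (S i); rewrite ?addr0 ?add0r.
have hd : (#|S| + #|predC S| = d)%N by rewrite cardC card_ord.
rewrite -(leq_add2r #|predC S|) hd; apply: leq_trans hc _.
by rewrite leq_add2l mxrank_indic_le.
Qed.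

Lemma qf_indic d (G P : 'M[C]_d) D (S : pred 'I_d) (x : 'rV[C]_d) :
  P *m G *m P^t* = diag_mx D ->
  qf G (x *m (indic S *m P)) = \sum_(i | S i) D 0 i * (x 0 i * (x 0 i)^*).
Proof.
move=> eD; rewrite /qf !trC_mul !mulmxA -(mulmxA _ P G) -(mulmxA _ _ (P^t*)) eD.
rewrite -mulmxA mxE [RHS]big_mkcond; apply: eq_bigr => i _.
rewrite -trC_mul !mul_mx_diag !mxE rmorphM /=.
by case: (S i); rewrite ?rmorph0 ?rmorph1 ?mulr0 ?mul0r ?mulr1 // mulrCA mulrA.
Qed.

Lemma npos_card d (G P : 'M[C]_d) D :
  P \in unitmx -> G = invmx P *m diag_mx D *m P ->
  npos G = #|[pred i | 0 < D 0 i]|.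
Proof.
move=> Pu /(perm_eigenvalues_diag Pu)/permP e.
by rewrite /npos e count_map cardE size_filter enumT.
Qed.

Lemma indic_neq0 d (P : 'M[C]_d) (S : pred 'I_d) (x : 'rV[C]_d) :
  x *m (indic S *m P) != 0 -> exists2 i, S i & x 0 i != 0.
Proof.
move=> nz; apply/exists_inP; apply: contraNT nz => /exists_inPn h.
suff e : x *m indic S = 0 by rewrite mulmxA e mul0mx.
apply/rowP => i; rewrite mul_mx_diag !mxE.
by case: (boolP (S i)) => [/h/negPn/eqP->|_]; rewrite ?mul0r ?mulr0.
Qed.

(** The eigenvectors with positive eigenvalue span such a subspace. With the next lemma, [npos G] is
    the largest dimension of a positive definite subspace. *)
Lemma npos_witness d (G : 'M[C]_d) : G^t* = G ->
  exists W : 'M[C]_d, \rank W = npos G /\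
   forall v : 'rV[C]_d, (v <= W)%MS -> v != 0 -> 0 < qf G v.
Proof.
move=> /hermitian_diagE[P [D [Pu e eD rD]]].
pose S := [pred i | 0 < D 0 i].
exists (indic S *m P); split.
  by rewrite mxrankMfree ?row_free_unit // mxrank_indic (npos_card Pu e).
move=> v /submxP[x ->] /indic_neq0[i Si xi].
rewrite (qf_indic _ _ eD) (bigD1 i) //=; apply: ltr_wpDr.
  by apply: sumr_ge0 => j /andP[Sj _]; rewrite mulr_ge0 ?mul_conjC_ge0 // ltW.
by rewrite mulr_gt0 // mul_conjC_gt0.
Qed.

(** The eigenvectors with nonpositive eigenvalue span a subspace [Z] of dimension d - npos G, which
    meets a positive definite subspace only in 0. *)
Lemma npos_max d (G : 'M[C]_d) k (W : 'M[C]_(k, d)) : G^t* = G ->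
   (forall v : 'rV[C]_d, (v <= W)%MS -> v != 0 -> 0 < qf G v) ->
   (\rank W <= npos G)%N.
Proof.
move=> /hermitian_diagE[P [D [Pu e eD rD]]] Wpos.
pose S := [pred i | 0 < D 0 i]; pose Z := indic (predC S) *m P.
have rZ : (npos G + \rank Z = d)%N.
  rewrite mxrankMfree ?row_free_unit // mxrank_indic (npos_card Pu e).
  by rewrite cardC card_ord.
have : (W :&: Z)%MS = 0.
  apply/eqP; rewrite -submx0; apply/rV_subP => v; rewrite sub_capmx => /andP[vW vZ].
  rewrite submx0; apply: contraT => nz; have := Wpos v vW nz.
  have /submxP[x ev] := vZ; rewrite ev (qf_indic _ _ eD) le_gtF //.
  apply: sumr_le0 => i /= Si; rewrite mulr_le0_ge0 ?mul_conjC_ge0 //.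
  by rewrite real_leNgt ?rD ?real0.
move/mxrank_disjoint_sum => eW; rewrite -(leq_add2r (\rank Z)) rZ -eW.
exact: rank_leq_col.
Qed.

(** On a positive definite subspace of the pulled-back form, [A] is injective, since a vector in its
    kernel has value 0; the image is positive definite for [G]. *)
Lemma npos_restrict p q (A : 'M[C]_(p, q)) (G : 'M[C]_q) : G^t* = G ->
  (npos (A *m G *m A^t*) <= npos G)%N.
Proof.
move=> hG; have hA : (A *m G *m A^t*)^t* = A *m G *m A^t*.
  by rewrite !trC_mul trmxCK hG mulmxA.
have [W [<- Wpos]] := npos_witness hA.
have qA (v : 'rV_p) : qf (A *m G *m A^t*) v = qf G (v *m A).
  by rewrite /qf trC_mul !mulmxA.
have <- : \rank (W *m A) = \rank W.
  apply/mxrank_injP; rewrite -submx0; apply/rV_subP => v.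
  rewrite sub_capmx => /andP[vW /sub_kermxP vA].
  rewrite submx0; apply: contraT => /(Wpos v vW).
  by rewrite qA vA /qf !mul0mx mxE ltxx.
apply: npos_max => // v /submxP[x ->] nz.
rewrite mulmxA -qA Wpos ?submxMl //.
by apply: contraNneq nz; rewrite mulmxA => ->; rewrite mul0mx.
Qed.

Lemma nneg_npos d (G : 'M[C]_d) : G^t* = G -> nneg G = npos (- G).
Proof.
move=> /hermitian_diagE[P [D [Pu e _ _]]].
have eN : - G = invmx P *m diag_mx (- D) *m P.
  by rewrite {1}e linearN /= mulmxN mulNmx.
rewrite (npos_card Pu eN) /nneg (permP (perm_eigenvalues_diag Pu e)).
rewrite count_map cardE size_filter enumT; apply: eq_count => i /=.
by rewrite !inE mxE oppr_gt0.
Qed.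

Lemma trCN m n (A : 'M[C]_(m, n)) : (- A)^t* = - A^t*.
Proof. by rewrite linearN /= map_mxN. Qed.

Lemma nneg_restrict p q (A : 'M[C]_(p, q)) (G : 'M[C]_q) : G^t* = G ->
  (nneg (A *m G *m A^t*) <= nneg G)%N.
Proof.
move=> hG; have hA : (A *m G *m A^t*)^t* = A *m G *m A^t*.
  by rewrite !trC_mul trmxCK hG mulmxA.
have hN : (- G)^t* = - G by rewrite trCN hG.
by rewrite !nneg_npos // -mulNmx -mulmxN npos_restrict.
Qed.

Lemma signatureE d (G : 'M[C]_d) : signature G = (npos G)%:Z - (nneg G)%:Z.
Proof. by []. Qed.

(** Sylvester's law of inertia, from one inequality of indices for each pullback. Rectangular [A]
    and [B] allow comparing spanning families of different lengths, such as those given by [kermx]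
    and by [row_base]. *)
Lemma signature_congr p q (A : 'M[C]_(p, q)) (B : 'M[C]_(q, p)) G H :
  G^t* = G -> H^t* = H -> H = A *m G *m A^t* -> G = B *m H *m B^t* ->
  signature H = signature G.
Proof.
move=> hG hH eH eG; rewrite !signatureE.
suff [-> ->] : npos H = npos G /\ nneg H = nneg G by [].
by split; apply/eqP; rewrite eqn_leq {1}eH [X in _ && (_ X <= _)%N]eG
  ?npos_restrict ?nneg_restrict.
Qed.

Lemma signature_block p q (G : 'M[C]_p) (H : 'M[C]_q) :
  signature (block_mx G 0 0 H) = signature G + signature H.
Proof.
have pe : perm_eq (eigenvalues (block_mx G 0 0 H)) (eigenvalues G ++ eigenvalues H).
  apply: prod_XsubC_eq; rewrite big_cat /= -!char_poly_eigenvalues /char_poly.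
  by rewrite char_block_diag_mx det_ublock.
rewrite !signatureE /npos /nneg !(permP pe) !count_cat !PoszD; ring.
Qed.

Lemma npos_gt0 d (G : 'M[C]_d) : G^t* = G -> (0 < npos G)%N -> exists x, 0 < qf G x.
Proof.
move=> hG; have [W [<- Wpos]] := npos_witness hG.
rewrite lt0n mxrank_eq0 => /rowV0Pn[v vW v0].
by exists v; apply: Wpos.
Qed.

Lemma nneg_gt0 d (G : 'M[C]_d) : G^t* = G -> (0 < nneg G)%N -> exists x, qf G x < 0.
Proof.
move=> hG; rewrite nneg_npos //; have hN : (- G)^t* = - G by rewrite trCN hG.
move=> /(npos_gt0 hN)[x]; rewrite /qf mulmxN mulNmx mxE oppr_gt0.
by exists x.
Qed.

Lemma npos_nneg0 d (G : 'M[C]_d) : G^t* = G -> npos G = 0%N -> nneg G = 0%N -> G = 0.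
Proof.
move=> /hermitian_diagE[P [D [Pu e _ rD]]].
rewrite /npos /nneg !(permP (perm_eigenvalues_diag Pu e)) !count_map.
move=> /eqP p0 /eqP n0; rewrite e; suff -> : D = 0 by rewrite raddf0 mulmx0 mul0mx.
apply/rowP => i; rewrite !mxE; move: p0 n0; rewrite !eqn0Ngt -!has_count.
rewrite -enumT.
move=> /hasPn/(_ i); rewrite mem_enum => /(_ isT)/= p0.
move=> /hasPn/(_ i); rewrite mem_enum => /(_ isT)/= n0.
by apply/eqP; move: p0 n0; case: (real_ltgt0P (rD i)).
Qed.

(** Without a common sign, one form would be positive and the other negative semidefinite; both
    being nonzero, their signatures would have opposite signs. *)
Lemma signature_same_sign p q (G : 'M[C]_p) (H : 'M[C]_q) :
  G^t* = G -> H^t* = H -> G != 0 -> H != 0 -> signature G = signature H ->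
  exists x y, 0 < qf G x * qf H y.
Proof.
move=> hG hH nG nH; rewrite !signatureE => e.
have nzG : (0 < npos G + nneg G)%N.
  rewrite lt0n addn_eq0; apply: contraNN nG => /andP[/eqP a /eqP b].
  by rewrite (npos_nneg0 hG a b).
have nzH : (0 < npos H + nneg H)%N.
  rewrite lt0n addn_eq0; apply: contraNN nH => /andP[/eqP a /eqP b].
  by rewrite (npos_nneg0 hH a b).
have [[a b]|[a b]] : (0 < npos G /\ 0 < npos H \/ 0 < nneg G /\ 0 < nneg H)%N by lia.
  have [x hx] := npos_gt0 hG a; have [y hy] := npos_gt0 hH b.
  by exists x, y; rewrite mulr_gt0.
have [x hx] := nneg_gt0 hG a; have [y hy] := nneg_gt0 hH b.
by exists x, y; rewrite nmulr_rgt0.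
Qed.

End Inertia.

(** * The trace form on intertwining maps *)

Lemma expmxS (K : pzRingType) d (N : 'M[K]_d) i : N ^+ i.+1 = N *m N ^+ i.
Proof. exact: exprS. Qed.

Lemma expmxSr (K : pzRingType) d (N : 'M[K]_d) i : N ^+ i.+1 = N ^+ i *m N.
Proof. exact: exprSr. Qed.

Lemma expmxD (K : pzRingType) d (N : 'M[K]_d) i j : N ^+ (i + j) = N ^+ i *m N ^+ j.
Proof. exact: exprD. Qed.

Lemma trC_sum (C : numClosedFieldType) (I : Type) (r : seq I) (P : pred I) m n
    (F : I -> 'M[C]_(m, n)) :
  (\sum_(i <- r | P i) F i)^t* = \sum_(i <- r | P i) (F i)^t*.
Proof. by rewrite !raddf_sum. Qed.

Section SkewUnitary.
Variables (C : numClosedFieldType).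

Lemma comm_shift_inv d (B Bi : 'M[C]_d) (l : C) k : B *m Bi = 1%:M ->
  (B - l%:M) ^+ k *m Bi = Bi *m (B - l%:M) ^+ k.
Proof.
move=> BBi; apply/esym; apply: (@commrX _ Bi (B - l%:M) k).
apply: (esym (_ : (B - l%:M) *m Bi = Bi *m (B - l%:M))).
by rewrite mulmxBl mulmxBr BBi (mulmx1C BBi) scalar_mxC.
Qed.

Lemma comm_shift d (B Bi : 'M[C]_d) (a l : C) j k : B *m Bi = 1%:M ->
  (B - l%:M) ^+ j *m (a *: (Bi *m (B - l%:M))) ^+ k
  = (a *: (Bi *m (B - l%:M))) ^+ k *m (B - l%:M) ^+ j.
Proof.
move=> BBi; set N := B - l%:M.
have cN : N *m Bi = Bi *m N by have := comm_shift_inv l 1 BBi; rewrite expr1.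
have cP : GRing.comm N (a *: (Bi *m N)).
  change (N *m (a *: (Bi *m N)) = (a *: (Bi *m N)) *m N).
  by rewrite -scalemxAr -scalemxAl mulmxA cN.
exact: (commrX _ (commr_sym (commrX _ (commr_sym cP)))).
Qed.

Lemma nilpotent_shift_vanish p d (x : 'M[C]_(p, d)) (B Bi : 'M[C]_d) (a mu : C) m j k :
  B *m Bi = 1%:M -> x *m (B - mu%:M) ^+ m = 0 -> (m <= j + k)%N ->
  x *m (B - mu%:M) ^+ j *m (a *: (Bi *m (B - mu%:M))) ^+ k = 0.
Proof.
move=> BBi; set N := B - mu%:M.
have cNX i : N ^+ i *m Bi = Bi *m N ^+ i := comm_shift_inv mu i BBi.
elim: k x j => [|k IH] x j xm h.
  by rewrite addn0 in h; rewrite expr0 mulmx1 -(subnKC h) expmxD mulmxA xm mul0mx.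
rewrite expmxS mulmxA -scalemxAr !mulmxA -[_ *m _ *m Bi]mulmxA cNX !mulmxA.
rewrite -scalemxAl -[_ *m N ^+ j *m N]mulmxA -expmxSr.
rewrite IH ?scaler0 //; last by rewrite addSnnS.
by rewrite -mulmxA -cNX mulmxA xm mul0mx.
Qed.

(** The vector x (B - mu)^m is killed by B - mu, so the inverse [Bi] of [B] acts on it as 1/mu, and
    each of the k factors contributes a/mu. *)
Lemma nilpotent_shift_top p d (x : 'M[C]_(p, d)) (B Bi : 'M[C]_d) (a mu : C) m j k :
  B *m Bi = 1%:M -> mu != 0 -> x *m (B - mu%:M) ^+ m.+1 = 0 -> (j + k = m)%N ->
  x *m (B - mu%:M) ^+ j *m (a *: (Bi *m (B - mu%:M))) ^+ k
  = (a / mu) ^+ k *: (x *m (B - mu%:M) ^+ m).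
Proof.
move=> BBi mu0; set N := B - mu%:M.
have cNX i : N ^+ i *m Bi = Bi *m N ^+ i := comm_shift_inv mu i BBi.
elim: k x j => [|k IH] x j xm h.
  by rewrite !expr0 mulmx1 scale1r -h addn0.
rewrite expmxS mulmxA -scalemxAr !mulmxA -[_ *m _ *m Bi]mulmxA cNX !mulmxA.
rewrite -scalemxAl -[_ *m N ^+ j *m N]mulmxA -expmxSr.
rewrite IH; first last.
- by rewrite -h addSnnS.
- by rewrite -mulmxA -cNX mulmxA xm mul0mx.
rewrite [in RHS]exprS mulrAC -!scalerA; congr (_ *: (_ *: _)).
have e : x *m N ^+ m *m B = mu *: (x *m N ^+ m).
  by apply/eqP; rewrite -subr_eq0 -mul_mx_scalar -mulmxBr -mulmxA -expmxSr xm.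
have <- : x *m N ^+ m *m B *m Bi = x *m N ^+ m by rewrite -mulmxA BBi mulmx1.
by rewrite -mulmxA -cNX mulmxA e -!scalemxAl scalerA mulVf ?scale1r.
Qed.

Variables (d : nat) (J B : 'M[C]_d).

(** [B] acts on row vectors and preserves the skew-Hermitian form with matrix [J]. *)
Definition skew_unitary := [/\ J^t* = - J, J \in unitmx & B *m J *m B^t* = J].

Hypothesis hJB : skew_unitary.

Let Bi := J *m B^t* *m invmx J.

Lemma skew_unitary_mulV : B *m Bi = 1%:M.
Proof.
by case: hJB => _ Ju e; rewrite /Bi !mulmxA e mulmxV.
Qed.

Lemma skew_unitary_unit : B \in unitmx.
Proof. by have /mulmx1_unit[] := skew_unitary_mulV. Qed.

(** The adjoint of B - l is B^-1 - conj l = - conj l B^-1 (B - 1/conj l). Thus crossing [J]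
    exchanges the eigenvalues l and 1/conj l, up to an invertible factor commuting with B. *)
Lemma skew_unitary_shift l : l != 0 ->
  J *m (B - l%:M)^t* = ((- l^*) *: (Bi *m (B - (l^*)^-1%:M))) *m J.
Proof.
move=> l0; have l0' : l^* != 0 by rewrite conjC_eq0.
have [_ Ju _] := hJB.
rewrite linearB /= map_mxB tr_scalar_mx map_scalar_mx !mulmxBr.
rewrite (mulmx1C skew_unitary_mulV) scalerBr mulmxBl -!scalemxAl mul1mx.
rewrite !mul_mx_scalar -!scalemxAl scalerA mulNr divff // scaleN1r opprK.
by rewrite /Bi mulmxKV // scaleNr addrC.
Qed.

Lemma skew_unitary_shiftX l k : l != 0 ->
  J *m ((B - l%:M) ^+ k)^t* =
  ((- l^*) *: (Bi *m (B - (l^*)^-1%:M))) ^+ k *m J.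
Proof.
move=> l0; elim: k => [|k IH]; first by rewrite !expr0 trmx1 map_mx1 mul1mx mulmx1.
rewrite expmxS trC_mul mulmxA IH -mulmxA skew_unitary_shift //.
by rewrite mulmxA -expmxSr.
Qed.

End SkewUnitary.

(* When N^m g = 0 and b N'^m = 0 this intertwines N and N', whatever the
   position of g and b in the Jordan chains. *)
Definition jordan_hom (K : pzRingType) d d' (N : 'M[K]_d) (N' : 'M[K]_d') m
    (g : 'cV[K]_d) (b : 'rV[K]_d') : 'M[K]_(d, d') :=
  \sum_(j < m) N ^+ j *m g *m b *m N' ^+ (m.-1 - j).

Lemma jordan_homP (K : pzRingType) d d' (N : 'M[K]_d) (N' : 'M[K]_d') m g b :
  N ^+ m *m g = 0 -> b *m N' ^+ m = 0 ->
  N *m jordan_hom N N' m g b = jordan_hom N N' m g b *m N'.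
Proof.
case: m => [_ _|m ng bn]; first by rewrite /jordan_hom !big_ord0 mulmx0 mul0mx.
rewrite /jordan_hom mulmx_sumr mulmx_suml big_ord_recr big_ord_recl /=.
rewrite !mulmxA -expmxS ng !mul0mx addr0 subn0.
rewrite -[X in _ = X + _]mulmxA -expmxSr -mulmxA bn mulmx0 add0r.
apply: eq_bigr => i _; rewrite /bump /= add1n !mulmxA -expmxS.
by rewrite -[RHS]mulmxA -expmxSr subnSK.
Qed.

Section TraceForm.
Variables (C : numClosedFieldType) (d d' : nat).
Variables (J B : 'M[C]_d) (J' B' : 'M[C]_d').
Hypotheses (hJB : skew_unitary J B) (hJB' : skew_unitary J' B').

(* tr (X X^dag), where X^dag = J' X^* J^-1 is the adjoint of X for the
   skew-Hermitian forms J and J'. *)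
Definition trace_form (X Y : 'M[C]_(d, d')) : C :=
  \tr (X *m J' *m Y^t* *m invmx J).

(** The two signs coming from the skew forms [J] and [J'] cancel, which makes the trace form
    Hermitian. *)
Lemma trace_form_conj X Y : (trace_form X Y)^* = trace_form Y X.
Proof.
have [hJ Ju _] := hJB; have [hJ' _ _] := hJB'.
rewrite /trace_form -mxtrace_tr -trace_map_mx !trC_mul trmxCK hJ'.
have -> : (invmx J)^t* = - invmx J.
  have h : (invmx J)^t* *m J^t* = 1%:M by rewrite -trC_mul mulmxV // trmx1 map_mx1.
  by rewrite -[LHS](mulmxK Ju) -[_ *m J]opprK -mulmxN -hJ h mulNmx mul1mx.
by rewrite mxtrace_mulC !mulmxA !(mulmxN, mulNmx) opprK.
Qed.

Lemma tr_col_row p (u : 'cV[C]_p) (v : 'rV[C]_p) : \tr (u *m v) = (v *m u) 0 0.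
Proof. by rewrite mxtrace_mulC /mxtrace big_ord1. Qed.

(* Only the terms with j + l = m survive in the double sum, and they are all equal. *)
Lemma trace_form_jordan_hom (l : C) m (a c : 'rV[C]_d) (b e : 'rV[C]_d') :
  let mu := (l^*)^-1 in
  let N := B - l%:M in let M := B - mu%:M in
  let N' := B' - l%:M in let M' := B' - mu%:M in
  l != 0 -> a *m M ^+ m.+1 = 0 -> c *m N ^+ m.+1 = 0 ->
  b *m N' ^+ m.+1 = 0 -> e *m M' ^+ m.+1 = 0 ->
  trace_form (jordan_hom N N' m.+1 (J *m a^t*) b)
             (jordan_hom M M' m.+1 (J *m c^t*) e)
  = - (m.+1%:R * (- (l ^+ 2)^-1) ^+ m *
     ((c *m N ^+ m *m J *m a^t*) 0 0 * (b *m N' ^+ m *m J' *m e^t*) 0 0)).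
Proof.
move=> mu N M N' M' l0 am cm bm em.
have [hJ Ju _] := hJB; have [hJ' Ju' _] := hJB'.
have mu0 : mu != 0 by rewrite invr_eq0 conjC_eq0.
have muC : mu^* = l^-1 by rewrite /mu fmorphV /= conjCK.
set F := (c *m _ *m J *m _) 0 0; set G := (b *m _ *m J' *m _) 0 0.
pose P := (- l^-1) *: (J *m B^t* *m invmx J *m N).
pose P' := (- l^-1) *: (J' *m B'^t* *m invmx J' *m N').
have JM k : J *m (M ^+ k)^t* = P ^+ k *m J.
  by rewrite skew_unitary_shiftX // muC invrK.
have JM' k : J' *m (M' ^+ k)^t* = P' ^+ k *m J'.
  by rewrite skew_unitary_shiftX // muC invrK.
have cPN j k : N ^+ j *m P ^+ k = P ^+ k *m N ^+ j.
  exact: comm_shift (skew_unitary_mulV hJB).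
have kap : - l^-1 / l = - (l ^+ 2)^-1 by rewrite mulNr -invfM expr2.
rewrite /trace_form /jordan_hom.
have -> : - (m.+1%:R * (- (l ^+ 2)^-1) ^+ m * (F * G)) =
   \sum_(j < m.+1) - ((- (l ^+ 2)^-1) ^+ m * (F * G)).
  by rewrite sumr_const card_ord -[in RHS]mulr_natl mulrN -mulrA.
rewrite !mulmx_suml raddf_sum; apply: eq_bigr => j _ /=.
(* Each summand is a product of rank one maps, so its trace is a product of two scalars, one for
   each form. *)
have E l' : (l' <= m)%N ->
  \tr (N ^+ j *m (J *m a^t*) *m b *m N' ^+ (m - j) *m J' *m
        (M ^+ l' *m (J *m c^t*) *m e *m M' ^+ (m - l'))^t* *m invmx J) =
  - ((b *m N' ^+ (m - j) *m P' ^+ (m - l') *m J' *m e^t*) 0 0 *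
     (c *m N ^+ j *m P ^+ l' *m J *m a^t*) 0 0).
  move=> lm.
  rewrite !trC_mul trmxCK hJ.
  have -> : N ^+ j *m (J *m a^t*) *m b *m N' ^+ (m - j) *m J' *m
     ((M' ^+ (m - l'))^t* *m (e^t* *m (c *m (- J) *m (M ^+ l')^t*))) *m invmx J
   = (N ^+ j *m (J *m a^t*)) *m ((b *m N' ^+ (m - j) *m P' ^+ (m - l') *m J' *m e^t*)
     *m (- (c *m P ^+ l'))).
    rewrite !mulmxA -[_ *m J' *m _]mulmxA JM' !mulmxA.
    rewrite !(mulmxN, mulNmx); congr (- _).
    rewrite -[_ *m J *m (M ^+ l')^t*]mulmxA JM !mulmxA mulmxK //.
  rewrite tr_col_row -mulmxA mulNmx mulmxN mxE [X in - X]mxE big_ord1.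
  by rewrite !mulmxA -[c *m P ^+ l' *m _]mulmxA -cPN !mulmxA.
rewrite trC_sum mulmx_sumr mulmx_suml raddf_sum.
rewrite (bigD1 (rev_ord j)) //= big1 ?addr0 => [|i ij].
  rewrite subSS E ?leq_subr //.
  have jm : (j <= m)%N by rewrite -ltnS.
  rewrite (nilpotent_shift_top _ (skew_unitary_mulV hJB) l0 cm) ?subnKC //.
  rewrite subKn // (nilpotent_shift_top _ (skew_unitary_mulV hJB') l0 bm) ?subnK //.
  have sc (z : C) (Q : 'M_1) : (z *: Q) 0 0 = z * Q 0 0 by rewrite mxE.
  rewrite kap -!scalemxAl !sc -/F -/G mulrACA -exprD subnKC //.
  by rewrite [G * F]mulrC.
have im : (i <= m)%N by rewrite -ltnS.
(* If j + i > m the scalar for [J] vanishes; if j + i < m the exponents in the scalar for [J'] add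
   up to more than m, and that one vanishes. *)
rewrite E //; have [ijm|ijm] := leqP m.+1 (j + i).
  rewrite [c *m N ^+ j *m _](nilpotent_shift_vanish _ (skew_unitary_mulV hJB) cm) //.
  by rewrite !mul0mx [X in _ * X]mxE mulr0 oppr0.
rewrite [b *m N' ^+ _ *m _](nilpotent_shift_vanish _ (skew_unitary_mulV hJB') bm).
  by rewrite !mul0mx [X in X * _]mxE mul0r oppr0.
have : (i != m - j :> nat)%N.
  by apply: contra ij => /eqP eij; apply/eqP/val_inj; rewrite /= subSS.
lia.
Qed.

End TraceForm.

(** * Ranks of powers and the pairing of generalized eigenspaces *)

Lemma orthogonal_kermx (F : fieldType) m n p (A : 'M[F]_(m, n)) (v : 'M[F]_(m, p)) :
  kermx A *m v = 0 -> exists w, v = A *m w.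
Proof.
move=> Kv; suff /submxP[D e] : (v^T <= A^T)%MS.
  by exists D^T; apply: trmx_inj; rewrite trmx_mul trmxK.
(* The row space of A^T lies in its double annihilator, and a dimension count gives equality. *)
have sA : (A^T <= kermx (kermx A)^T)%MS.
  by apply/sub_kermxP; rewrite -trmx_mul mulmx_ker trmx0.
have rA : \rank A^T = \rank (kermx (kermx A)^T).
  by rewrite mxrank_ker !mxrank_tr mxrank_ker subKn // rank_leq_row.
have /eqmxP eA : (A^T == kermx (kermx A)^T)%MS by rewrite -(mxrank_leqif_eq sA) rA.
by rewrite eA; apply/sub_kermxP; rewrite -trmx_mul Kv trmx0.
Qed.

(** The exponent m + 1 is the first at which the ranks stabilize. For N = B - l it is the largest
    size of a Jordan block of B at l. *)
Lemma rank_stable_power (F : fieldType) d (N : 'M[F]_d) : (\rank N < d)%N ->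
  exists m, (\rank (N ^+ m.+1) < \rank (N ^+ m))%N /\
            \rank (N ^+ m.+2) = \rank (N ^+ m.+1).
Proof.
move=> rN; have dec i : (\rank (N ^+ i.+1) <= \rank (N ^+ i))%N.
  by rewrite expmxS mxrankM_maxr.
have ex : exists i, (\rank (N ^+ i.+1) == \rank (N ^+ i))%N.
  have claim k : (exists i, (\rank (N ^+ i.+1) == \rank (N ^+ i))%N) \/
      (\rank (N ^+ k) + k <= d)%N.
    elim: k => [|k [ex|IH]]; [by right; rewrite addn0 rank_leq_row|by left|].
    have := dec k; rewrite leq_eqVlt => /orP[e|lt]; first by left; exists k.
    by right; rewrite addnS; apply: leq_trans IH; rewrite ltn_add2r.
  by case: (claim d.+1) => //; lia.
case: (ex_minnP ex) => -[|m] /eqP e minm.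
  by move: rN; rewrite -[N]expr1 e expr0 mxrank1 ltnn.
exists m; split=> //; rewrite ltn_neqAle dec andbT.
by apply: contraTN isT => /minm; rewrite ltnn.
Qed.

Lemma rank_drop_vector (F : fieldType) d (N : 'M[F]_d) m :
  (\rank (N ^+ m.+1) < \rank (N ^+ m))%N ->
  exists2 c : 'rV[F]_d, c *m N ^+ m.+1 = 0 & c *m N ^+ m != 0.
Proof.
move=> lt; set K := kermx (N ^+ m.+1).
have : K *m N ^+ m != 0.
  apply: contraTneq lt => e; rewrite -leqNgt.
  have : (K <= kermx (N ^+ m))%MS by apply/sub_kermxP.
  move/mxrankS; rewrite !mxrank_ker.
  have := rank_leq_row (N ^+ m); have := rank_leq_row (N ^+ m.+1); lia.
case/rowV0Pn => u /submxP[w ->]; rewrite mulmxA => nz.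
by exists (w *m K) => //; rewrite -mulmxA mulmx_ker mulmx0.
Qed.

Section Pairing.
Variables (C : numClosedFieldType) (d : nat) (J B : 'M[C]_d).
Hypothesis hJB : skew_unitary J B.

Lemma shift_factor (Bi : 'M[C]_d) a mu k : B *m Bi = 1%:M ->
  exists Q, (a *: (Bi *m (B - mu%:M))) ^+ k = Q *m (B - mu%:M) ^+ k.
Proof.
move=> BBi; elim: k => [|k [Q IH]]; first by exists 1%:M; rewrite !expr0 mul1mx.
exists (a *: (Q *m Bi)); rewrite expmxSr IH.
have := comm_shift a mu k 1 BBi; rewrite expr1 -mulmxA => ->.
by rewrite -scalemxAl -scalemxAr -scalemxAl expmxS !mulmxA.
Qed.

(** Otherwise c N^m would be orthogonal to the kernel of M^(m+1) and hence lie in the image of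
    N^(m+1). It is also in the kernel of N, and stability of the rank makes these two spaces meet
    only in 0. *)
Lemma pairing_nondegenerate l m (c : 'rV[C]_d) : l != 0 ->
  \rank ((B - l%:M) ^+ m.+2) = \rank ((B - l%:M) ^+ m.+1) ->
  c *m (B - l%:M) ^+ m.+1 = 0 -> c *m (B - l%:M) ^+ m != 0 ->
  exists2 a : 'rV[C]_d, a *m (B - ((l^*)^-1)%:M) ^+ m.+1 = 0 &
    (c *m (B - l%:M) ^+ m *m J *m a^t*) 0 0 != 0.
Proof.
move=> l0 rk cN cNn; set N := B - l%:M; set M := B - _.
have [_ Ju _] := hJB; pose K := kermx (M ^+ m.+1).
set x := c *m N ^+ m *m J.
have [e|/rowV0Pn[u /submxP[w ->] nz]] := eqVneq (K *m x^t*) 0; last first.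
  exists (w *m K); first by rewrite -mulmxA mulmx_ker mulmx0.
  apply: contra nz => /eqP e; apply/eqP; rewrite mulmxA -[LHS]trmxCK trC_mul trmxCK.
  by rewrite -/x in e; rewrite [_ *m _]mx11_scalar e raddf0 trmx0 map_mx0.
have [w ew] := orthogonal_kermx e.
have ex : x = w^t* *m (M ^+ m.+1)^t* by rewrite -trC_mul -ew trmxCK.
have Bi1 := skew_unitary_mulV hJB.
have mu0 : (l^*)^-1 != 0 by rewrite invr_eq0 conjC_eq0.
have ex2 : c *m N ^+ m = w^t* *m invmx J *m (J *m (M ^+ m.+1)^t*) *m invmx J.
  by rewrite !mulmxA mulmxKV // -ex mulmxK.
move: ex2; rewrite (skew_unitary_shiftX hJB _ mu0) fmorphV /= conjCK invrK.
have [Q ->] := shift_factor (- l^-1) l m.+1 Bi1.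
rewrite !mulmxA mulmxK // -/N; set y := _ *m Q => ey.
have yk : y *m N ^+ m.+2 = 0.
  by rewrite expmxSr mulmxA -ey -mulmxA -expmxSr.
have /mxrank_injP/eqP cap0 : \rank (N ^+ m.+1 *m N) = \rank (N ^+ m.+1).
  by rewrite -expmxSr.
case/negP: cNn; rewrite ey -submx0 -cap0 sub_capmx submxMl /=.
by apply/sub_kermxP; rewrite -mulmxA -expmxSr.
Qed.
End Pairing.

(** * Isotropy of the trace form, and the forms at unit eigenvalues *)

Section TraceFormAlgebra.
Variables (C : numClosedFieldType) (d d' : nat).
Variables (J B : 'M[C]_d) (J' B' : 'M[C]_d').
Hypotheses (hJB : skew_unitary J B) (hJB' : skew_unitary J' B').
Local Notation T := (trace_form J J').

Lemma trace_formDl X X' Y : T (X + X') Y = T X Y + T X' Y.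
Proof. by rewrite /trace_form !mulmxDl raddfD. Qed.

Lemma trace_formZl a X Y : T (a *: X) Y = a * T X Y.
Proof. by rewrite /trace_form -!scalemxAl mxtraceZ. Qed.

Lemma trace_formDr X Y Y' : T X (Y + Y') = T X Y + T X Y'.
Proof.
by rewrite -[LHS](trace_form_conj hJB hJB') trace_formDl rmorphD /=
  !(trace_form_conj hJB hJB').
Qed.

Lemma trace_formZr a X Y : T X (a *: Y) = a^* * T X Y.
Proof.
by rewrite -[LHS](trace_form_conj hJB hJB') trace_formZl rmorphM /=
  !(trace_form_conj hJB hJB').
Qed.

Lemma trace_form_invariant X Y : B *m X = X *m B' -> B *m Y = Y *m B' ->
  T (B *m X) (B *m Y) = T X Y.
Proof.
move=> eX eY; rewrite eX eY /trace_form trC_mul !mulmxA.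
have [_ _ e] := hJB'.
by rewrite -[_ *m J' *m _]mulmxA -[_ *m B' *m _]mulmxA [B' *m _]mulmxA e.
Qed.

(* Expanding the invariance T (B X) (B Y) = T X Y around l gives
   (1 - |l|^2) T X Y = 0 up to terms of lower nilpotency order. *)
Lemma trace_form_isotropic l X Y a b : l * l^* != 1 ->
  B *m X = X *m B' -> B *m Y = Y *m B' ->
  (B - l%:M) ^+ a *m X = 0 -> (B - l%:M) ^+ b *m Y = 0 -> T X Y = 0.
Proof.
move=> l1; set N := B - l%:M.
have BZ p (Z : 'M_(d, p)) : B *m Z = l *: Z + N *m Z.
  by rewrite /N mulmxBl mul_scalar_mx addrC subrK.
have NB : N *m B = B *m N by rewrite /N mulmxBl mulmxBr scalar_mxC.
have cN Z : B *m Z = Z *m B' -> B *m (N *m Z) = (N *m Z) *m B'.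
  by move=> e; rewrite mulmxA -NB -mulmxA e mulmxA.
elim: {a b}(a + b)%N {-2}a {-2}b (leqnn (a + b)) X Y => [|s IH] a b le X Y eX eY aX bY.
  move: le aX; rewrite leqn0 addn_eq0 => /andP[/eqP-> _].
  by rewrite expr0 mul1mx => ->; rewrite /trace_form !mul0mx mxtrace0.
case: a => [|a] in le aX *.
  by move: aX; rewrite expr0 mul1mx => ->; rewrite /trace_form !mul0mx mxtrace0.
case: b => [|b] in le bY *.
  move: bY; rewrite expr0 mul1mx => ->.
  by rewrite /trace_form trmx0 map_mx0 mulmx0 mul0mx mxtrace0.
have aNX : N ^+ a *m (N *m X) = 0 by rewrite mulmxA -expmxSr.
have bNY : N ^+ b *m (N *m Y) = 0 by rewrite mulmxA -expmxSr.
have := trace_form_invariant eX eY.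
rewrite !BZ trace_formDl !trace_formDr !trace_formZl !trace_formZr.
have cX := cN _ eX; have cY := cN _ eY.
have le1 : (a + b.+1 <= s)%N by [].
have le2 : (a.+1 + b <= s)%N by rewrite addSnnS.
have le3 : (a + b <= s)%N by apply: ltnW.
rewrite (IH a b.+1 le1 (N *m X) Y) // (IH a.+1 b le2 X (N *m Y)) //.
rewrite (IH a b le3 (N *m X) (N *m Y)) //.
rewrite !mulr0 !addr0 mulrA => e; apply/eqP.
have : (l * l^* - 1) * T X Y == 0 by rewrite mulrBl e mul1r subrr.
by rewrite mulf_eq0 subr_eq0 (negbTE l1).
Qed.

End TraceFormAlgebra.

Section CircleForm.
Variables (C : numClosedFieldType).

Definition form_coef (l : C) m : C := if odd m then 'i else l^-1.

(* The form of index m in row vectors, for B = A^T: the row x stands for the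
   column x^T, so the second argument becomes x^t*. *)
Definition circle_form d (J B : 'M[C]_d) (l : C) m : 'M[C]_d :=
  form_coef l m *: ((B - l%:M) ^+ m./2 *m J *m ((B - l%:M) ^+ m.-1./2)^t*).

(** The rows of [kermx] span the kernel with redundancy. The signature is unaffected, and the matrix
    keeps the fixed size d. *)
Definition circle_gram d (J B : 'M[C]_d) (l : C) m : 'M[C]_d :=
  let K := kermx ((B - l%:M) ^+ m) in K *m circle_form J B l m *m K^t*.

(* On ker N^(m+1) the form of index m+1 is this multiple of x N^m J y^*. *)
Definition top_coef (l : C) m : C := form_coef l m.+1 * (- (l ^+ 2)^-1) ^+ m./2.

(** The right-hand side is, up to the factor m + 1, the coefficient in [trace_form_jordan_hom]; so
    on the circle that trace is a positive multiple of a product of two values of top forms. *)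
Lemma top_coef_sqr l m : top_coef l m ^+ 2 = - (- (l ^+ 2)^-1) ^+ m.
Proof.
rewrite /top_coef exprMn -exprM muln2 /form_coef /= -{3}(odd_double_half m).
case: (odd m) => /=; last by rewrite sqrCi mulN1r add0n.
by rewrite add1n [in RHS]exprS mulNr opprK exprVn.
Qed.

Lemma circle_neq0 (l : C) : l * l^* = 1 -> l != 0.
Proof. by move=> h; apply: contra_eq_neq h => ->; rewrite mul0r eq_sym oner_eq0. Qed.

Lemma circle_conjV (l : C) : l * l^* = 1 -> l^* = l^-1.
Proof. by move=> h; rewrite -[RHS]mulr1 -h mulKf // circle_neq0. Qed.

Variables (d : nat) (J B : 'M[C]_d).
Hypothesis hJB : skew_unitary J B.
Variables (l : C) (m : nat).
Hypothesis l1 : l * l^* = 1.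

Let N := B - l%:M.

(** On the circle 1/conj l = l, so the second factor crosses [J] as a power of the same shift. The
    exponents add up to m, where [nilpotent_shift_top] applies. *)
Lemma top_circle_form p (x : 'M[C]_(p, d)) : x *m N ^+ m.+1 = 0 ->
  x *m circle_form J B l m.+1 = top_coef l m *: (x *m N ^+ m *m J).
Proof.
move=> xN; have l0 := circle_neq0 l1; have lV := circle_conjV l1.
rewrite /circle_form -mulmxA (skew_unitary_shiftX hJB) // -/N.
rewrite lV invrK -scalemxAr !mulmxA.
have e := nilpotent_shift_top (- l^-1) (j := (m.+1)./2) (k := m./2)
  (skew_unitary_mulV hJB) l0 xN.
rewrite -/N in e; rewrite e; last by rewrite -[m.+1./2]/(uphalf m) uphalf_half; lia.
rewrite -scalemxAl scalerA /top_coef; congr (_ * _ *: _).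
by rewrite mulNr -invfM expr2.
Qed.

Lemma circle_gramE : let K := kermx (N ^+ m.+1) in
  circle_gram J B l m.+1 = top_coef l m *: (K *m N ^+ m *m J *m K^t*).
Proof. by rewrite /circle_gram top_circle_form ?mulmx_ker // -scalemxAl. Qed.


Lemma top_coef_unit : top_coef l m * (top_coef l m)^* = 1.
Proof.
have l0 := circle_neq0 l1; have lV := circle_conjV l1.
have tu : - (l ^+ 2)^-1 * (- (l ^+ 2)^-1)^* = 1.
  rewrite rmorphN fmorphV rmorphXn /= lV mulrNN exprVn invrK mulVf //.
  by rewrite expf_neq0.
rewrite /top_coef rmorphM rmorphXn /= mulrACA -exprMn tu expr1n mulr1 /form_coef.
case: odd; first by rewrite conjCi mulrN -expr2 sqrCi opprK.
by rewrite fmorphV /= lV invrK mulVf.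
Qed.

(** Taking the adjoint moves N^m across [J], which produces the factor t^2 for t = [top_coef l m].
    As t has modulus 1, conj t times t^2 is t again. *)
Lemma circle_form_top_herm p (x : 'M[C]_(p, d)) : x *m N ^+ m.+1 = 0 ->
  (top_coef l m *: (x *m N ^+ m *m J *m x^t*))^t* =
  top_coef l m *: (x *m N ^+ m *m J *m x^t*).
Proof.
move=> xN; have l0 := circle_neq0 l1; have lV := circle_conjV l1.
have [hJ _ _] := hJB.
rewrite linearZ /= map_mxZ !trC_mul trmxCK hJ mulNmx mulmxN [J *m (_ *m _)]mulmxA.
rewrite (skew_unitary_shiftX hJB) // lV invrK.
have e := nilpotent_shift_top (- l^-1) (j := 0) (k := m)
  (skew_unitary_mulV hJB) l0 xN erefl.
rewrite expr0 mulmx1 in e; rewrite !mulmxA e -!scalemxAl scalerN -scaleNr scalerA.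
congr (_ *: _).
have -> : - l^-1 / l = - (l ^+ 2)^-1 by rewrite mulNr -invfM expr2.
by rewrite mulNr -mulrN -top_coef_sqr expr2 mulrCA mulrA top_coef_unit mul1r.
Qed.

Lemma circle_gram_herm : (circle_gram J B l m.+1)^t* = circle_gram J B l m.+1.
Proof. by rewrite circle_gramE circle_form_top_herm ?mulmx_ker. Qed.

Lemma circle_gram_qf x : let v := x *m kermx (N ^+ m.+1) in
  v *m N ^+ m.+1 = 0 /\
  qf (circle_gram J B l m.+1) x = top_coef l m * qf (N ^+ m *m J) v.
Proof.
move=> v; split; first by rewrite -mulmxA mulmx_ker mulmx0.
rewrite circle_gramE /qf -scalemxAr -scalemxAl mxE; congr (_ * _).
by rewrite /v; move: (kermx _) => K; rewrite trC_mul !mulmxA.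
Qed.

(** On the circle both vectors of the nondegenerate pairing lie in the same kernel, so the Gram
    matrix has a nonzero value. *)
Lemma circle_gram_neq0 : \rank (N ^+ m.+2) = \rank (N ^+ m.+1) ->
  (\rank (N ^+ m.+1) < \rank (N ^+ m))%N -> circle_gram J B l m.+1 != 0.
Proof.
move=> rk lt; have l0 := circle_neq0 l1; have lV := circle_conjV l1.
set K := kermx (N ^+ m.+1).
have [c cN nz] := rank_drop_vector lt.
have /submxP[w ec] : (c <= K)%MS by apply/sub_kermxP.
have [a aM nza] := pairing_nondegenerate hJB l0 rk cN nz.
rewrite lV invrK -/N in aM.
have /submxP[z ez] : (a <= K)%MS by apply/sub_kermxP.
apply: contra nza => /eqP; rewrite circle_gramE -/K => e.
have e0 : K *m N ^+ m *m J *m K^t* = 0.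
  apply: (scalerI (a := top_coef l m)); last by rewrite e scaler0.
  apply: contraTneq isT => k0; have := top_coef_unit.
  by rewrite k0 mul0r => /eqP; rewrite eq_sym oner_eq0.
have -> : c *m N ^+ m *m J *m a^t* = w *m (K *m N ^+ m *m J *m K^t*) *m z^t*.
  by rewrite ec ez; move: (K) => K'; rewrite trC_mul !mulmxA.
by rewrite e0 mulmx0 mul0mx mxE.
Qed.

End CircleForm.

(* For l = 1 or -1 and an odd index, conjugation reverses the sign of the form. *)
Lemma circle_gram_real_sign (C : numClosedFieldType) d (J B : 'M[C]_d) l m v :
  map_mx Num.conj J = J -> map_mx Num.conj B = B -> l * l^* = 1 -> l^* = l -> odd m.+1 ->
  v *m (B - l%:M) ^+ m.+1 = 0 ->
  exists2 v', v' *m (B - l%:M) ^+ m.+1 = 0 &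
   top_coef l m * qf ((B - l%:M) ^+ m *m J) v'
   = - (top_coef l m * qf ((B - l%:M) ^+ m *m J) v)^*.
Proof.
move=> cJ cB l1 lR om vN; set N := B - l%:M.
have cN k : map_mx Num.conj (N ^+ k) = N ^+ k.
  elim: k => [|k IH]; first by rewrite expr0 map_mx1.
  by rewrite expmxS map_mxM IH map_mxB cB map_scalar_mx /= lR.
exists (map_mx Num.conj v); first by rewrite -[N ^+ _]cN -map_mxM vN map_mx0.
have -> : qf (N ^+ m *m J) (map_mx Num.conj v) = (qf (N ^+ m *m J) v)^*.
  rewrite /qf; transitivity (map_mx Num.conj (v *m (N ^+ m *m J) *m v^t*) 0 0);
    last by rewrite mxE.
  by rewrite !map_mxM cN cJ map_trmx.
rewrite rmorphM -mulNr; congr (_ * _).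
rewrite /top_coef /form_coef om rmorphM rmorphXn rmorphN fmorphV rmorphXn /= lR.
by rewrite conjCi mulNr opprK.
Qed.

Section JordanHom.
Variables (C : numClosedFieldType) (d d' : nat).
Variables (J B : 'M[C]_d) (J' B' : 'M[C]_d').
Hypotheses (hJB : skew_unitary J B) (hJB' : skew_unitary J' B').

Lemma shift_kernel (A Ai : 'M[C]_d) a mu k p (u : 'M[C]_(d, p)) :
  A *m Ai = 1%:M -> a != 0 -> (a *: (Ai *m (A - mu%:M))) ^+ k *m u = 0 ->
  (A - mu%:M) ^+ k *m u = 0.
Proof.
move=> AAi a0; elim: k u => [//|k IH] u.
rewrite expmxSr -mulmxA => /IH; rewrite mulmxA.
have := comm_shift a mu k 1 AAi; rewrite expr1 => ->.
rewrite -!scalemxAl -!mulmxA [X in _ *: (_ *m X)]mulmxA -expmxS => /eqP.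
rewrite scaler_eq0 (negbTE a0) => /eqP/(congr1 (mulmx A)).
by rewrite mulmxA AAi mul1mx mulmx0.
Qed.

Lemma dual_kernel l m (a : 'rV[C]_d) : l != 0 ->
  a *m (B - ((l^*)^-1)%:M) ^+ m = 0 -> (B - l%:M) ^+ m *m (J *m a^t*) = 0.
Proof.
move=> l0 aM; have mu0 : (l^*)^-1 != 0 by rewrite invr_eq0 conjC_eq0.
have := skew_unitary_shiftX hJB m mu0; rewrite fmorphV /= conjCK invrK => e.
have h : J *m ((B - ((l^*)^-1)%:M) ^+ m)^t* *m a^t* = 0.
  by rewrite -mulmxA -trC_mul aM trmx0 map_mx0 mulmx0.
move: h; rewrite e -[X in X = _]mulmxA => h.
apply: shift_kernel (skew_unitary_mulV hJB) _ h.
by rewrite oppr_eq0 invr_eq0.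
Qed.

Lemma jordan_hom_comm l m (a : 'rV[C]_d) (b : 'rV[C]_d') : l != 0 ->
  a *m (B - ((l^*)^-1)%:M) ^+ m = 0 -> b *m (B' - l%:M) ^+ m = 0 ->
  let X := jordan_hom (B - l%:M) (B' - l%:M) m (J *m a^t*) b in
  B *m X = X *m B' /\ (B - l%:M) ^+ m *m X = 0.
Proof.
move=> l0 aM bN X; have gN := dual_kernel l0 aM.
have := jordan_homP gN bN; rewrite -/X mulmxBl mulmxBr scalar_mxC => /addIr ->.
split=> //; rewrite {}/X; move: (J *m a^t*) gN => g gN.
rewrite mulmx_sumr big1 // => j _; rewrite !mulmxA.
by rewrite -expmxD addnC expmxD -[_ *m g]mulmxA gN !(mul0mx, mulmx0).
Qed.

End JordanHom.

(** * Intertwining maps of positive trace *)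

Section PositiveHom.
Variables (C : numClosedFieldType) (d d' : nat).
Variables (J B : 'M[C]_d) (J' B' : 'M[C]_d').
Hypotheses (hJB : skew_unitary J B) (hJB' : skew_unitary J' B').

Lemma positive_hom_circle l m v v' : l * l^* = 1 ->
  v *m (B - l%:M) ^+ m.+1 = 0 -> v' *m (B' - l%:M) ^+ m.+1 = 0 ->
  0 < (top_coef l m * qf ((B - l%:M) ^+ m *m J) v) *
      (top_coef l m * qf ((B' - l%:M) ^+ m *m J') v') ->
  exists Z : 'M_(d, d'), B *m Z = Z *m B' /\ 0 < trace_form J J' Z Z.
Proof.
move=> l1 vN vN' pos; have l0 := circle_neq0 l1; have lV := circle_conjV l1.
have e : (l^*)^-1 = l by rewrite lV invrK.
have hv : v *m (B - ((l^*)^-1)%:M) ^+ m.+1 = 0 by rewrite e.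
have [cX _] := jordan_hom_comm hJB l0 hv vN'.
have := trace_form_jordan_hom hJB hJB' l0 hv vN vN'; rewrite /= e => /(_ _ vN') eT.
exists (jordan_hom (B - l%:M) (B' - l%:M) m.+1 (J *m v^t*) v'); split=> //.
rewrite eT -mulrA -mulrN -mulNr -top_coef_sqr pmulr_rgt0 ?ltr0n //.
by rewrite expr2; rewrite mulrACA /qf !mulmxA in pos.
Qed.

Lemma positive_hom_off_circle l m : l != 0 -> l * l^* != 1 ->
  \rank ((B - l%:M) ^+ m.+2) = \rank ((B - l%:M) ^+ m.+1) ->
  (\rank ((B - l%:M) ^+ m.+1) < \rank ((B - l%:M) ^+ m))%N ->
  \rank ((B' - l%:M) ^+ m.+2) = \rank ((B' - l%:M) ^+ m.+1) ->
  (\rank ((B' - l%:M) ^+ m.+1) < \rank ((B' - l%:M) ^+ m))%N ->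
  exists Z : 'M_(d, d'), B *m Z = Z *m B' /\ 0 < trace_form J J' Z Z.
Proof.
move=> l0 l1 st /rank_drop_vector[c cN cNn] st' /rank_drop_vector[b bN bNn].
have [a aM nza] := pairing_nondegenerate hJB l0 st cN cNn.
have [e eM nze] := pairing_nondegenerate hJB' l0 st' bN bNn.
have [cX nX] := jordan_hom_comm hJB l0 aM bN.
have eT := trace_form_jordan_hom hJB hJB' l0 aM cN bN eM.
have mu0 : (l^*)^-1 != 0 by rewrite invr_eq0 conjC_eq0.
have muV : (((l^*)^-1)^*)^-1 = l by rewrite fmorphV /= conjCK invrK.
have mu1 : (l^*)^-1 * ((l^*)^-1)^* != 1.
  by rewrite fmorphV /= conjCK -invfM invr_eq1 mulrC.
have cN' : c *m (B - ((((l^*)^-1)^*)^-1)%:M) ^+ m.+1 = 0 by rewrite muV.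
have [cY nY] := jordan_hom_comm hJB mu0 cN' eM.
rewrite /= in eT; set X := jordan_hom _ _ _ _ b in cX nX eT.
set Y := jordan_hom _ _ _ _ e in cY nY eT.
have TX := trace_form_isotropic hJB hJB' l1 cX cX nX nX.
have TY := trace_form_isotropic hJB hJB' mu1 cY cY nY nY.
(* With t = T X Y and T X X = T Y Y = 0, the map X + t Y has trace 2 |t|^2. *)
exists (X + trace_form J J' X Y *: Y); split.
  by rewrite mulmxDr mulmxDl -scalemxAr -scalemxAl cX cY.
rewrite trace_formDl trace_formZl !(trace_formDr hJB hJB') !(trace_formZr hJB hJB').
rewrite TX TY -(trace_form_conj hJB hJB' X Y) mulr0 addr0 add0r mulrC -mulr2n.
rewrite pmulrn_rgt0 // mul_conjC_gt0 eT oppr_eq0 !mulf_neq0 ?pnatr_eq0 //.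
by rewrite expf_neq0 // oppr_eq0 invr_eq0 expf_neq0.
Qed.

End PositiveHom.

Section SameData.
Variable R : realType.
Let C : numClosedFieldType := R[i].

(* P l m selects the forms whose signatures are compared. *)
Definition same_data (P : C -> nat -> Prop) d d' (J B : 'M[C]_d) (J' B' : 'M[C]_d') :=
  (forall l r, \rank ((B - l%:M) ^+ r) = \rank ((B' - l%:M) ^+ r)) /\
  (forall l m, l * l^* = 1 -> P l m.+1 ->
     signature (circle_gram J B l m.+1) = signature (circle_gram J' B' l m.+1)).

(* At l = 1 and l = -1 the forms of odd index carry no information, and since
   the matrices are real one of l and l^* is enough. *)
Definition adequate (P : C -> nat -> Prop) := forall l, l * l^* = 1 ->
  (l^* = l -> forall m, odd m -> P l m.+1) /\
  (l^* != l -> (forall m, P l m.+1) \/ (forall m, P l^* m.+1)).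

(** A nonzero Hermitian form takes a nonzero value, and a negative one is made positive by passing
    to the conjugate vector. *)
Lemma circle_gram_pos_vector d (J B : 'M[C]_d) l m :
  skew_unitary J B -> map_mx Num.conj J = J -> map_mx Num.conj B = B ->
  l * l^* = 1 -> l^* = l -> odd m.+1 -> circle_gram J B l m.+1 != 0 ->
  exists2 v, v *m (B - l%:M) ^+ m.+1 = 0 &
    0 < top_coef l m * qf ((B - l%:M) ^+ m *m J) v.
Proof.
move=> hJB cJ cB l1 lR om nz; have hG := circle_gram_herm hJB m l1.
have [a|] := ltnP 0 (npos (circle_gram J B l m.+1)).
  have [x] := npos_gt0 hG a; have [vN ->] := circle_gram_qf hJB m l1 x.
  by move=> h; exists (x *m kermx ((B - l%:M) ^+ m.+1)).
rewrite leqn0 => /eqP p0.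
have a : (0 < nneg (circle_gram J B l m.+1))%N.
  rewrite lt0n; apply: contra nz => /eqP n0; apply/eqP; exact: npos_nneg0.
have [x] := nneg_gt0 hG a; have [vN ->] := circle_gram_qf hJB m l1 x => neg.
have [v' v'N e] := circle_gram_real_sign cJ cB l1 lR om vN.
exists v' => //; rewrite e oppr_gt0.
by rewrite (CrealP _) // ltr0_real.
Qed.

Lemma exists_positive_hom P d d' (J B : 'M[C]_d) (J' B' : 'M[C]_d') :
  adequate P -> skew_unitary J B -> skew_unitary J' B' ->
  map_mx Num.conj J = J -> map_mx Num.conj B = B ->
  map_mx Num.conj J' = J' -> map_mx Num.conj B' = B' ->
  same_data P J B J' B' -> (0 < d)%N ->
  exists Z : 'M_(d, d'), B *m Z = Z *m B' /\ 0 < trace_form J J' Z Z.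
Proof.
move=> adP hJB hJB' cJ cB cJ' cB' [D1 D2] d0.
have [l /eigenvalueP[u eu u0]] := @eigenvalue_closed _ _ B d0.
have ev : (\rank (B - l%:M)%R < d)%N.
  rewrite ltn_neqAle rank_leq_row andbT; apply: contra u0 => rf.
  apply/eqP/(row_free_inj rf); rewrite mul0mx mulmxBr mul_mx_scalar eu subrr.
  by [].
have l0 : l != 0.
  apply: contraNneq u0 => l0; rewrite l0 scale0r in eu.
  by rewrite -(mulmxK (skew_unitary_unit hJB) u) eu mul0mx.
have [l1|l1] := eqVneq (l * l^*) 1; last first.
  have [m [lt st]] := rank_stable_power ev.
  by apply: (positive_hom_off_circle hJB hJB' (l := l) (m := m)); rewrite // -!D1.
(* For nonreal l on the circle, l may have to be replaced by its conjugate, also an eigenvalue of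
   the real matrix [B], to reach a point where signatures are compared. *)
have {l u eu u0 l0 ev l1} [l [l1 ev good]] : exists l : C,
  [/\ l * l^* = 1, (\rank (B - l%:M)%R < d)%N &
   (forall m, P l m.+1) \/ (l^* = l /\ forall m, odd m -> P l m.+1)].
  have [p1 p2] := adP l l1.
  have [lR|lR] := eqVneq l^* l.
    by exists l; split=> //; right; split=> //; apply: p1.
  case: (p2 lR) => p; first by exists l; split=> //; left.
  exists l^*; split; [by rewrite conjCK mulrC| |by left].
  by rewrite -cB -map_scalar_mx -map_mxB mxrank_map.
have [m [lt st]] := rank_stable_power ev.
(* Equality of ranks gives [B'] the same largest block size m + 1 at l. *)
have lt' := lt; have st' := st; rewrite !D1 in lt' st'.
have nz := circle_gram_neq0 hJB l1 st lt.
have nz' := circle_gram_neq0 hJB' l1 st' lt'.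
have [Plm|[lR om]] : P l m.+1 \/ (l^* = l /\ odd m.+1).
  case: good => [|[lR]]; first by left.
  by case: (boolP (odd m)) => om /(_ m) p; [left; apply: p|right].
- have [x [y]] := signature_same_sign (circle_gram_herm hJB m l1)
                    (circle_gram_herm hJB' m l1) nz nz' (D2 l m l1 Plm).
  have [vN ->] := circle_gram_qf hJB m l1 x.
  have [vN' ->] := circle_gram_qf hJB' m l1 y.
  exact: positive_hom_circle.
- have [v vN pv] := circle_gram_pos_vector hJB cJ cB l1 lR om nz.
  have [v' vN' pv'] := circle_gram_pos_vector hJB' cJ' cB' l1 lR om nz'.
  by apply: (positive_hom_circle hJB hJB' l1 vN vN'); rewrite mulr_gt0.
Qed.

End SameData.

(** * Square roots and isometric summands *)

(** The real counterpart of [skew_unitary]. The matrix [J] is arbitrary because the induction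
    restricts the form to invariant summands, in bases that are not symplectic. *)
Definition symp_pair (F : fieldType) d (J B : 'M[F]_d) :=
  [/\ J^T = - J, J \in unitmx & B *m J *m B^T = J].

Section RealPart.
Variable R : realType.
Let C : numClosedFieldType := R[i].

Lemma complexify_conj p q (M : 'M[R]_(p, q)) :
  map_mx Num.conj (complexify M : 'M[C]_(p, q)) = complexify M.
Proof. by apply/matrixP => i j; rewrite !mxE; apply: conjc_real. Qed.

Lemma complexify_tr p q (M : 'M[R]_(p, q)) :
  (complexify M : 'M[C]_(p, q))^t* = complexify M^T.
Proof. by rewrite -map_trmx complexify_conj /complexify map_trmx. Qed.

Lemma symp_skew_unitary d (J B : 'M[R]_d) : symp_pair J B ->
  @skew_unitary C d (complexify J) (complexify B).
Proof.
move=> [hJ Ju e]; split.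
- by rewrite complexify_tr hJ /complexify map_mxN.
- by rewrite map_unitmx.
- by rewrite complexify_tr /complexify -!map_mxM e.
Qed.

Lemma ReIm_mx p q (Z : 'M[C]_(p, q)) :
  exists X Y : 'M[R]_(p, q), Z = complexify X + 'i *: complexify Y.
Proof.
exists (map_mx (@complex.Re R) Z), (map_mx (@complex.Im R) Z).
by apply/matrixP => i j; rewrite !mxE [LHS]complexE.
Qed.

Lemma ReIm_inj p q (X Y X' Y' : 'M[R]_(p, q)) :
  complexify X + 'i *: complexify Y = complexify X' + 'i *: complexify Y' :> 'M[C]_(p, q) ->
  X = X' /\ Y = Y'.
Proof.
have entry (U V : 'M[R]_(p, q)) i j :
    (complexify U + 'i *: complexify V : 'M[C]_(p, q)) i j = (U i j +i* V i j)%C.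
  rewrite mxE [X in _ + X]mxE [complexify U i j]mxE [complexify V i j]mxE.
  by rewrite [RHS]complexE.
move=> /matrixP e; split; apply/matrixP => i j.
  by have := e i j; rewrite (entry X Y) (entry X' Y'); case.
by have := e i j; rewrite (entry X Y) (entry X' Y'); case.
Qed.

(** Since [B] and [B'] are real, the real part X and the imaginary part Y of Z intertwine them as
    well. The real part of T Z Z is T X X + T Y Y, so one of these summands is positive. *)
Lemma real_positive_hom d d' (J B : 'M[R]_d) (J' B' : 'M[R]_d') (Z : 'M[C]_(d, d')) :
  symp_pair J B -> symp_pair J' B' -> complexify B *m Z = Z *m complexify B' ->
  0 < trace_form (complexify J) (complexify J') Z Z ->
  exists X : 'M[R]_(d, d'), B *m X = X *m B' /\ 0 < \tr (X *m J' *m X^T *m invmx J).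
Proof.
move=> hJB hJB'; have [X [Y ->]] := ReIm_mx Z.
rewrite mulmxDr mulmxDl -scalemxAr -scalemxAl /complexify -!map_mxM.
move=> /ReIm_inj[eX eY]; set T := fun U V : 'M_(d, d') => \tr (U *m J' *m V^T *m invmx J).
have -> : trace_form (complexify J) (complexify J')
    (complexify X + 'i *: complexify Y) (complexify X + 'i *: complexify Y) =
   (T X X + T Y Y)%:C%C + 'i * (T Y X - T X Y)%:C%C :> C.
  have tc U V : \tr (complexify U *m complexify J' *m complexify V^T *m invmx (complexify J))
     = (T U V)%:C%C :> C.
    by rewrite /T /complexify -trace_map_mx !map_mxM map_invmx.
  have tf U V : trace_form (complexify J) (complexify J') (complexify U) (complexify V)
      = (T U V)%:C%C :> C by rewrite /trace_form complexify_tr tc.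
  have h := symp_skew_unitary hJB; have h' := symp_skew_unitary hJB'.
  rewrite trace_formDl trace_formZl !(trace_formDr h h') !(trace_formZr h h') !tf.
  rewrite conjCi rmorphD rmorphB /= mulrDr !mulNr !mulrN mulrA -expr2 sqrCi mulN1r opprK.
  ring.
rewrite ltcE => /andP[_].
rewrite /= !(mul0r, mul1r, mulr0, subr0, addr0, oppr0, add0r) => pos.
have [|] := ltP 0 (T X X) => h; first by exists X.
by exists Y; split=> //; rewrite -/(T Y Y); lra.
Qed.


Lemma trace_eigenvalues d (H : 'M[C]_d) : (0 < d)%N ->
  \tr H = \sum_(z <- eigenvalues H) z.
Proof.
move=> d0; apply: oppr_inj; rewrite -char_poly_trace // char_poly_eigenvalues.
have sz : size (eigenvalues H) = d.
  apply: succn_inj; rewrite -(size_prod_XsubC (eigenvalues H) id).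
  by rewrite -char_poly_eigenvalues size_char_poly.
have -> : d.-1 = (size (eigenvalues H)).-1 by rewrite sz.
by rewrite coefPn_prod_XsubC // sz -lt0n.
Qed.

(** The trace is the sum of the real parts of the complex eigenvalues, so one of these is
    positive. *)
Lemma eigenvalue_Re_gt0 d (H : 'M[R]_d) : 0 < \tr H ->
  exists c : C, 0 < complex.Re c /\
    (exists2 v : 'rV[C]_d, v != 0 & v *m complexify H = c *: v).
Proof.
case: d H => [|d] H pos; first by move: pos; rewrite /mxtrace big_ord0 ltxx.
have e : \sum_(z <- eigenvalues (complexify H)) complex.Re z = \tr H.
  have := trace_eigenvalues (complexify H) (ltn0Sn d).
  rewrite /complexify trace_map_mx => /(congr1 (@complex.Re R)) /= ->.
  by rewrite raddf_sum.
have /hasP[c cin cpos] : has (fun z : C => 0 < complex.Re z) (eigenvalues (complexify H)).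
  apply: contraLR pos => /hasPn h; rewrite -leNgt -e big_seq.
  by apply: sumr_le0 => z /h; rewrite -leNgt.
exists c; split=> //; have : root (char_poly (complexify H)) c.
  by rewrite char_poly_eigenvalues root_prod_XsubC.
by rewrite -eigenvalue_root_char => /eigenvalueP[v ev v0]; exists v.
Qed.

(** For real c > 0 the constant 1/sqrt c serves. For nonreal c the numbers 1 and c form a real basis
    of the complex plane, in which a square root of 1/c is expanded. *)
Lemma real_linear_sqrt (c : C) : 0 < complex.Re c ->
  exists a b : R, (a%:C%C * c + b%:C%C) ^+ 2 * c = 1.
Proof.
case: c => x y /= x0; have [->|y0] := eqVneq y 0.
  exists 0, (Num.sqrt x)^-1.
  change (x +i* 0)%C with (x%:C)%C.
  rewrite mul0r add0r -rmorphXn -rmorphM exprVn sqr_sqrtr ?ltW //.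
  by rewrite mulVf ?rmorph1 // gt_eqF.
set c := (x +i* y)%C; have c0 : c != 0.
  by apply/eqP => -[e _]; rewrite e ltxx in x0.
pose s := sqrtc c^-1; exists (complex.Im s / y), (complex.Re s - complex.Im s / y * x).
have -> : ((complex.Im s / y)%:C * c + (complex.Re s - complex.Im s / y * x)%:C)%C = s.
  case: s => u v; apply/eqP; rewrite eq_complex /= !mul0r !subr0 !addr0.
  by rewrite divfK // addrC subrK !eqxx.
by rewrite sqr_sqrtc mulVf.
Qed.

(** An eigenvector of [H] for c is killed by Q^2 H - 1, because a c + b is an inverse square root of
    c. *)
Lemma singular_square_root d (H : 'M[R]_d) : 0 < \tr H ->
  exists a b : R, let Q := a *: H + b%:M in
  (\rank (Q *m Q *m H - 1%:M)%R < d)%N.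
Proof.
move=> /eigenvalue_Re_gt0[c [cpos [v v0 ev]]].
have [a [b e]] := real_linear_sqrt cpos; exists a, b => Q.
rewrite ltn_neqAle rank_leq_row andbT; apply: contra v0 => rf.
have cQ : v *m complexify Q = (a%:C * c + b%:C)%C *: v.
  rewrite /complexify /Q map_mxD map_mxZ map_scalar_mx mulmxDr -scalemxAr ev.
  by rewrite mul_mx_scalar scalerA -scalerDl.
have rf' : row_free (complexify (Q *m Q *m H - 1%:M)) by rewrite /row_free mxrank_map.
apply/eqP/(row_free_inj rf'); rewrite mul0mx /complexify map_mxB map_mx1 !map_mxM.
rewrite mulmxBr mulmx1 !mulmxA cQ -!scalemxAl cQ -!scalemxAl ev !scalerA.
by rewrite -expr2 e scale1r subrr.
Qed.

End RealPart.

(** The coefficient 1/2 makes the terms linear in [E] cancel, so the new error is divisible by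
    E^2. *)
Lemma newton_error (F : fieldType) d (E : 'M[F]_d) : 2%:R != 0 :> F ->
  (1%:M - 2%:R^-1 *: E) *m (1%:M - 2%:R^-1 *: E) *m (1%:M + E) - 1%:M =
  E *m E *m ((- (3%:R / 4%:R))%:M + 4%:R^-1 *: E).
Proof.
move=> two0; have four0 : 4%:R != 0 :> F by rewrite (natrM _ 2 2) mulf_neq0.
rewrite !(mulmxDl, mulmxDr, mulmxN, mulNmx) -!(scalemxAl, scalemxAr).
rewrite !(mul1mx, mulmx1) -?scalemxAl ?mulmxA mul_mx_scalar.
move: (E *m E *m E) (E *m E) => E3 E2; apply/matrixP => i j; rewrite !mxE.
by field; rewrite four0 two0.
Qed.

Section Admissible.
Variables (F : fieldType) (d : nat) (H J : 'M[F]_d).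

(* The properties of polynomials in H that the square root argument uses. *)
Definition polylike (Q : 'M[F]_d) :=
  (forall Y, comm_mx H Y -> comm_mx Q Y) /\ Q *m J = J *m Q^T.

Lemma polylike_comm Q S : polylike Q -> polylike S -> comm_mx Q S.
Proof. by move=> [q _] [s _]; apply/q/comm_mx_sym/s. Qed.

Lemma polylike_scalar a : polylike a%:M.
Proof.
split=> [Y _|]; first exact: comm_scalar_mx.
by rewrite tr_scalar_mx scalar_mxC.
Qed.

Lemma polylikeD Q S : polylike Q -> polylike S -> polylike (Q + S).
Proof.
move=> [q qJ] [s sJ]; split=> [Y HY|].
  by apply/comm_mx_sym/comm_mxD; apply/comm_mx_sym; [apply: q|apply: s].
by rewrite mulmxDl linearD /= mulmxDr qJ sJ.
Qed.

Lemma polylikeZ a Q : polylike Q -> polylike (a *: Q).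
Proof.
move=> [q qJ]; split=> [Y /q e|].
  by rewrite /comm_mx -scalemxAl -scalemxAr e.
by rewrite -scalemxAl qJ linearZ /= -scalemxAr.
Qed.

Lemma polylikeM Q S : polylike Q -> polylike S -> polylike (Q *m S).
Proof.
move=> pQ pS; have e := polylike_comm pQ pS; have [[q qJ] [s sJ]] := (pQ, pS).
split=> [Y HY|].
  by apply/comm_mx_sym/comm_mxM; apply/comm_mx_sym; [apply: q|apply: s].
by rewrite [in RHS]e trmx_mul -mulmxA sJ mulmxA qJ mulmxA.
Qed.

Lemma polylikeX Q k : polylike Q -> polylike (Q ^+ k).
Proof.
move=> pQ; elim: k => [|k IH]; first exact: polylike_scalar.
by rewrite expmxS; apply: polylikeM.
Qed.

Hypothesis HJ : H *m J = J *m H^T.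

Lemma polylike_id : polylike H.
Proof. by split. Qed.

Hypothesis two_neq0 : 2%:R != 0 :> F.

(* Newton iteration Q |-> Q (1 - E / 2) with E = Q^2 H - 1, which squares the error. *)
Lemma newton_inverse_sqrt Q0 k : polylike Q0 ->
  exists Q S, [/\ polylike Q, polylike S &
    Q *m Q *m H - 1%:M = (Q0 *m Q0 *m H - 1%:M) ^+ (2 ^ k) *m S].
Proof.
move=> pQ0; elim: k => [|k [Q [S [pQ pS e]]]].
  by exists Q0, 1%:M; split; rewrite ?mulmx1 ?expr1 //; apply: polylike_scalar.
set E0 := _ ^+ _ in e; set E := _ - _ in e.
have p1 := polylike_scalar 1.
have pE : polylike E.
  apply: polylikeD; first by apply: polylikeM polylike_id; apply: polylikeM.
  by rewrite -scaleN1r; apply: polylikeZ.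
pose G := 1%:M - 2%:R^-1 *: E.
have pG : polylike G.
  by rewrite /G -scaleNr; apply: polylikeD => //; apply: polylikeZ.
pose S' := (- (3%:R / 4%:R))%:M + 4%:R^-1 *: E.
have pS' : polylike S'.
  by apply: polylikeD; [apply: polylike_scalar|apply: polylikeZ].
have pE0 : polylike E0.
  apply: polylikeX; apply: polylikeD; first by apply: polylikeM polylike_id; apply: polylikeM.
  by rewrite -scaleN1r; apply: polylikeZ.
exists (Q *m G), (S *m S *m S'); split; [exact: polylikeM|by do !apply: polylikeM|].
have -> : Q *m G *m (Q *m G) *m H = G *m G *m (1%:M + E).
  rewrite /E [1%:M + _]addrC subrK (polylike_comm pQ pG) -!mulmxA; congr (_ *m _).
  by rewrite !mulmxA (polylike_comm pQ pG).
rewrite expnS mulnC exprM -/E0 expr2 -[E0 * E0]/(E0 *m E0).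
have -> : E0 *m E0 *m (S *m S *m S') = E *m E *m S'.
  by rewrite e !mulmxA -[_ *m S *m E0]mulmxA (polylike_comm pS pE0) !mulmxA.
exact: newton_error.
Qed.

End Admissible.

Lemma rank_stable_iter (F : fieldType) d (N : 'M[F]_d) m k :
  \rank (N ^+ m.+1) = \rank (N ^+ m) -> \rank (N ^+ (m + k)) = \rank (N ^+ m).
Proof.
rewrite expmxSr => /mxrank_injP/eqP cap0; elim: k => [|k IH]; first by rewrite addn0.
rewrite addnS expmxSr -IH; apply/mxrank_injP; rewrite -submx0 -cap0.
by apply: capmxS => //; rewrite addnC expmxD submxMl.
Qed.

(* Fitting: when rank (P^2) = rank P the kernel and the image of P are
   complementary, and orthogonal because P is self-adjoint. *)
Lemma kernel_nondegenerate (F : fieldType) d (J P : 'M[F]_d) :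
  J \in unitmx -> P *m J = J *m P^T -> \rank (P *m P) = \rank P ->
  row_base (kermx P) *m J *m (row_base (kermx P))^T \in unitmx.
Proof.
move=> Ju PJ /mxrank_injP/eqP cap0.
have := row_base_free (kermx P); have := eq_row_base (kermx P).
move: (row_base _) => K eK fK.
have full : (1%:M <= K + P)%MS.
  have cap : (K :&: P)%MS = 0.
    by apply/eqP; rewrite -submx0 -cap0 capmxC; apply: capmxS; rewrite // eK.
  rewrite sub1mx -col_leq_rank (mxrank_disjoint_sum cap) eK mxrank_ker.
  by rewrite subnK // rank_leq_row.
rewrite -row_free_unit -kermx_eq0 -submx0; apply/rV_subP => x /sub_kermxP e.
have KP : K *m P = 0 by apply/sub_kermxP; rewrite eK.
have xJ : x *m K *m J = 0.
  have /submxP[D eD] : (1%:M <= col_mx K P)%MS by rewrite -addsmxE.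
  suff : x *m K *m J *m (col_mx K P)^T = 0.
    by move=> h; rewrite -[LHS]mulmx1 -trmx1 eD trmx_mul mulmxA h mul0mx.
  rewrite tr_col_mx mul_mx_row -[_ *m J *m P^T]mulmxA -PJ !mulmxA -[x *m K *m P]mulmxA KP.
  by rewrite mulmx0 mul0mx; rewrite !mulmxA in e; rewrite e row_mx0.
have xK : x *m K = 0 by rewrite -[LHS](mulmxK Ju) xJ mul0mx.
rewrite submx0; apply/eqP; apply: (row_free_inj fK).
by rewrite mul0mx.
Qed.

(** * Splitting off isometric summands *)

Section IsometricBlock.
Variables (R : realType) (d d' : nat).
Variables (J B : 'M[R]_d) (J' B' : 'M[R]_d').
Hypotheses (hJB : symp_pair J B) (hJB' : symp_pair J' B').

(* H = X X^dag is self-adjoint, commutes with B and has an eigenvalue of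
   positive real part; on a suitable generalized eigenspace K of H there is a
   polynomial Q in H with Q^2 H = 1, and then Q X is an isometry on K. *)
Lemma isometric_block (X : 'M[R]_(d, d')) : B *m X = X *m B' ->
  0 < \tr (X *m J' *m X^T *m invmx J) ->
  exists (e : nat) (C : 'M[R]_(e, d)) (C' : 'M[R]_(e, d')) (B1 : 'M[R]_e),
  [/\ (0 < e)%N, C *m B = B1 *m C, C' *m B' = B1 *m C',
      C *m J *m C^T \in unitmx & C' *m J' *m C'^T = C *m J *m C^T].
Proof.
move=> BX; set H := X *m J' *m X^T *m invmx J => pos.
have [hJ Ju eB] := hJB; have [hJ' Ju' eB'] := hJB'.
have HJ' : H *m J = X *m J' *m X^T by rewrite mulmxKV.
clearbody H; have HJ : H *m J = J *m H^T.
  apply: oppr_inj; rewrite -[RHS]mulNmx -hJ -trmx_mul HJ' !trmx_mul trmxK hJ'.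
  by rewrite mulNmx mulmxN mulmxA.
(* Both B H J B^T and H B J B^T equal H J, by invariance of the two forms; the invertible J and B^T
   are then cancelled. *)
have HB : comm_mx H B.
  have Bu : B \in unitmx.
    by have : B *m (J *m B^T *m invmx J) = 1%:M;
       [rewrite !mulmxA eB mulmxV|case/mulmx1_unit].
  have e1 : B *m H *m J *m B^T = H *m J.
    rewrite -!mulmxA [H *m _]mulmxA HJ' !mulmxA BX -[_ *m X^T *m B^T]mulmxA -trmx_mul BX.
    by rewrite trmx_mul !mulmxA -[X *m B' *m _]mulmxA -[X *m _ *m B'^T]mulmxA eB'.
  have e2 : B *m H *m J *m B^T = H *m B *m J *m B^T.
    by rewrite e1 -[in LHS]eB !mulmxA.
  have BTu : B^T \in unitmx by rewrite unitmx_tr.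
  by apply: esym; apply: (can_inj (mulmxK Ju)); apply: (can_inj (mulmxK BTu)).
have [a [b /= sing]] := singular_square_root pos; set Q0 := _ + b%:M in sing.
have pQ0 : polylike H J Q0.
  apply: polylikeD; [exact/polylikeZ/polylike_id|exact: polylike_scalar].
set E := _ - _ in sing.
have pE : polylike H J E.
  apply: polylikeD; last by rewrite -scaleN1r; apply/polylikeZ/polylike_scalar.
  by apply: polylikeM (polylike_id HJ); apply: polylikeM.
have [m [lt st]] := rank_stable_power sing.
set P := E ^+ m.+1; have pP : polylike H J P by apply: polylikeX.
have two0 : 2%:R != 0 :> R by rewrite pnatr_eq0.
(* After m + 1 Newton steps the error is a multiple of E^(2^(m+1)). As 2^(m+1) is at least m + 1, it
   vanishes on the kernel of P = E^(m+1). *)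
have [Q [S [pQ pS eQ]]] := newton_inverse_sqrt HJ two0 m.+1 pQ0.
rewrite -/E in eQ; have [/(_ _ HB) PB PJ] := pP.
pose K := row_base (kermx P); have eK : (K :=: kermx P)%MS := eq_row_base _.
have Ku : K *m J *m K^T \in unitmx.
  apply: kernel_nondegenerate => //.
  by rewrite /P -expmxD; apply: rank_stable_iter.
clearbody K.
have KP : K *m P = 0 by apply/sub_kermxP; rewrite eK.
have KQ : K *m (Q *m Q *m H) = K.
  apply/eqP; rewrite -subr_eq0 -{2}[K]mulmx1 -mulmxBr eQ.
  by rewrite -(subnKC (ltnW (ltn_expl m.+1 (ltnSn 1)))) expmxD !mulmxA KP !mul0mx.
have [/(_ _ HB) QB QJ] := pQ.
have /submxP[B1 KB] : (K *m B <= K)%MS.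
  by rewrite eK; apply/sub_kermxP; rewrite -mulmxA -PB mulmxA KP mul0mx.
exists _, K, (K *m Q *m X), B1; split.
- rewrite mxrank_ker subn_gt0; apply: leq_trans lt _; exact: rank_leq_row.
- exact: KB.
- by rewrite -[LHS]mulmxA -BX !mulmxA -[K *m Q *m B]mulmxA QB !mulmxA KB.
- exact: Ku.
(* The Gram matrix of K Q X is K Q H J Q^T K^T = K Q^2 H J K^T, and Q^2 H is the identity on K. *)
- have -> : K *m Q *m X *m J' *m (K *m Q *m X)^T = K *m Q *m (H *m J) *m Q^T *m K^T.
    by rewrite HJ' !trmx_mul !mulmxA.
  rewrite -!mulmxA [J *m (Q^T *m _)]mulmxA -QJ !mulmxA; congr (_ *m _ *m _).
  have cHQ : H *m Q = Q *m H by have [/(_ _ (comm_mx_refl H))] := pQ.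
  by rewrite -[_ *m H *m Q]mulmxA cHQ !mulmxA -[RHS]KQ !mulmxA.
Qed.

End IsometricBlock.

Lemma restrict_isometry (F : fieldType) d e (J B : 'M[F]_d) (C : 'M[F]_(e, d)) (B1 : 'M[F]_e) :
  C *m B = B1 *m C -> B *m J *m B^T = J ->
  B1 *m (C *m J *m C^T) *m B1^T = C *m J *m C^T.
Proof.
move=> CB eB; transitivity ((B1 *m C) *m J *m (B1 *m C)^T).
  by rewrite trmx_mul !mulmxA.
by rewrite -CB trmx_mul !mulmxA -[C *m B *m J]mulmxA -[C *m _ *m B^T]mulmxA eB.
Qed.

(** The rows of [D] span the orthogonal complement of those of [C], the kernel of J C^T. It is
    invariant because [B1] is invertible, and complementary because the Gram matrix of [C] is
    invertible. *)
Lemma orthogonal_split (F : fieldType) d e (J B : 'M[F]_d) (C : 'M[F]_(e, d)) (B1 : 'M[F]_e) :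
  symp_pair J B -> C *m B = B1 *m C -> C *m J *m C^T \in unitmx ->
  exists (f : nat) (D : 'M[F]_(f, d)) (B2 : 'M[F]_f) (Q : 'M[F]_(d, e + f)),
  [/\ (e + f)%N = d, col_mx C D *m Q = 1%:M, Q *m col_mx C D = 1%:M,
      col_mx C D *m B = block_mx B1 0 0 B2 *m col_mx C D &
      symp_pair (C *m J *m C^T) B1 /\ symp_pair (D *m J *m D^T) B2 /\
      col_mx C D *m J *m (col_mx C D)^T
        = block_mx (C *m J *m C^T) 0 0 (D *m J *m D^T)].
Proof.
move=> [hJ Ju eB] CB Gu.
have Cfree : row_free C.
  rewrite /row_free eqn_leq rank_leq_row /=.
  move: Gu; rewrite -row_full_unit => /eqP {1}<-.
  by rewrite -mulmxA mxrankM_maxl.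
set A := J *m C^T; have rA : \rank A = e.
  transitivity (\rank C); last exact/eqP.
  by rewrite -mxrank_tr /A trmx_mul trmxK hJ mulmxN mxrank_opp
    mxrankMfree // row_free_unit.
pose D := row_base (kermx A); have eD : (D :=: kermx A)%MS := eq_row_base _.
have Dfree : row_free D := row_base_free _.
have ef : (e + \rank (kermx A))%N = d.
  by rewrite mxrank_ker rA subnKC // -rA rank_leq_row.
clearbody D; move: (\rank (kermx A)) ef D eD Dfree => f ef D eD Dfree.
have DA : D *m A = 0 by apply/sub_kermxP; rewrite eD.
have symC : (C *m J *m C^T)^T = - (C *m J *m C^T).
  by rewrite !trmx_mul trmxK hJ mulNmx mulmxN mulmxA.
have symD : (D *m J *m D^T)^T = - (D *m J *m D^T).
  by rewrite !trmx_mul trmxK hJ mulNmx mulmxN mulmxA.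
have eB1 : B1 *m (C *m J *m C^T) *m B1^T = C *m J *m C^T.
  exact: restrict_isometry CB eB.
have B1u : B1 \in unitmx.
  have : B1 *m (C *m J *m C^T *m B1^T *m invmx (C *m J *m C^T)) = 1%:M.
    by rewrite !mulmxA; rewrite !mulmxA in eB1; rewrite eB1 mulmxV.
  by case/mulmx1_unit.
have BA : B *m A *m B1^T = A.
  by rewrite /A -!mulmxA -trmx_mul -CB trmx_mul !mulmxA eB.
have /submxP[B2 DB] : (D *m B <= D)%MS.
  rewrite eD; apply/sub_kermxP.
  have B1Tu : B1^T \in unitmx by rewrite unitmx_tr.
  apply: (can_inj (mulmxK B1Tu)).
  by rewrite mul0mx -[D *m B *m A]mulmxA -[_ *m B1^T]mulmxA BA DA.
have DC : D *m J *m C^T = 0 by rewrite -mulmxA.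
have CD : C *m J *m D^T = 0.
  by apply: trmx_inj; rewrite trmx0 !trmx_mul trmxK hJ mulNmx mulmxN mulmxA DC oppr0.
have eP : col_mx C D *m J *m (col_mx C D)^T
        = block_mx (C *m J *m C^T) 0 0 (D *m J *m D^T).
  by rewrite tr_col_mx mul_col_mx mul_col_row CD DC.
have cap : (C :&: D)%MS = 0.
  apply/eqP; rewrite -submx0; apply/rV_subP => v; rewrite sub_capmx.
  case/andP=> /submxP[x ->] xD; rewrite submx0; apply/eqP.
  have h : x *m (C *m J *m C^T) = 0.
    have : (x *m C <= kermx A)%MS by rewrite -eD.
    by move/sub_kermxP; rewrite /A !mulmxA.
  by rewrite -(mulmxK Gu x) h !mul0mx.
have rP : \rank (col_mx C D) = d.
  by rewrite -addsmxE (mxrank_disjoint_sum cap) (eqP Cfree) (eqP Dfree).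
have Pfull : row_full (col_mx C D) by rewrite /row_full rP.
have Pfree : row_free (col_mx C D) by rewrite /row_free rP ef.
(* The equality of e + f and d is not definitional, so the inverse of the rectangular [col_mx C D]
   is given as a separate matrix. *)
exists f, D, B2, (pinvmx (col_mx C D)).
have PQ := mulmxVp Pfree; have QP := mulVpmx Pfull.
have Du : D *m J *m D^T \in unitmx.
  have : col_mx C D *m J *m (col_mx C D)^T \in unitmx.
    rewrite -row_free_unit /row_free mxrankMfree; last first.
      by rewrite /row_free mxrank_tr rP.
    by rewrite mxrankMfree ?row_free_unit // rP ef.
  by rewrite eP unitmxE det_ublock unitrM => /andP[].
split=> //.
- by rewrite mul_col_mx mul_block_col CB DB !mul0mx addr0 add0r.
- split; [by split|split=> //; split=> //].
  exact: restrict_isometry DB eB.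
Qed.

(** * Additivity of the invariants and induction *)

Lemma expmx_block (K : pzRingType) p q (A : 'M[K]_p) (D : 'M[K]_q) k :
  block_mx A 0 0 D ^+ k = block_mx (A ^+ k) 0 0 (D ^+ k).
Proof.
elim: k => [|k IH]; first exact: scalar_mx_block.
by rewrite !expmxS IH mulmx_block !(mul0mx, mulmx0, addr0, add0r).
Qed.

Lemma sub_scalar_block (K : pzRingType) p q (A : 'M[K]_p) (D : 'M[K]_q) l :
  block_mx A 0 0 D - l%:M = block_mx (A - l%:M) 0 0 (D - l%:M).
Proof. by rewrite scalar_mx_block opp_block_mx add_block_mx !oppr0 !addr0. Qed.

Lemma expmx_intertwine (K : pzRingType) p q (M : 'M[K]_p) (N : 'M[K]_q) (P : 'M[K]_(p, q)) k :
  P *m N = M *m P -> P *m N ^+ k = M ^+ k *m P.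
Proof.
move=> e; elim: k => [|k IH]; first by rewrite !expr0 mulmx1 mul1mx.
by rewrite expmxS mulmxA e -mulmxA IH mulmxA -expmxS.
Qed.

Lemma kermx_block (F : fieldType) p q (A : 'M[F]_p) (D : 'M[F]_q) :
  (kermx (block_mx A 0 0 D) :=: block_mx (kermx A) 0 0 (kermx D))%MS.
Proof.
apply/eqmxP/andP; split.
  set K := kermx _; have : K *m block_mx A 0 0 D = 0 by rewrite mulmx_ker.
  rewrite -[K]hsubmxK mul_row_block !mulmx0 addr0 add0r -row_mx0 => /eq_row_mx[eA eD].
  have /submxP[a ->] : (lsubmx K <= kermx A)%MS by apply/sub_kermxP.
  have /submxP[b ->] : (rsubmx K <= kermx D)%MS by apply/sub_kermxP.
  apply/submxP; exists (row_mx a b).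
  by rewrite mul_row_block !mulmx0 addr0 add0r.
apply/sub_kermxP; move: (mulmx_ker A) (mulmx_ker D).
move: (kermx A) (kermx D) => K L KA LD; rewrite mulmx_block KA LD.
by rewrite !mul0mx !mulmx0 !addr0 block_mx0.
Qed.

Section Data.
Variable R : realType.
Let C : numClosedFieldType := R[i].

Lemma signature_basis d p q (F : 'M[C]_d) (K : 'M[C]_(p, d)) (L : 'M[C]_(q, d)) :
  (K :=: L)%MS -> (K *m F *m K^t*)^t* = K *m F *m K^t* ->
  (L *m F *m L^t*)^t* = L *m F *m L^t* ->
  signature (K *m F *m K^t*) = signature (L *m F *m L^t*).
Proof.
move=> e hK hL.
have /submxP[a ea] : (K <= L)%MS by rewrite e.
have /submxP[b eb] : (L <= K)%MS by rewrite e.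
apply: (signature_congr (A := a) (B := b)) => //.
  by rewrite {1 2}ea trC_mul !mulmxA.
by rewrite {1 2}eb trC_mul !mulmxA.
Qed.

Lemma rank_shift_congr d e (B : 'M[C]_d) (B1 : 'M[C]_e) (P : 'M[C]_(e, d)) Q l r :
  P *m Q = 1%:M -> Q *m P = 1%:M -> P *m B = B1 *m P ->
  \rank ((B1 - l%:M) ^+ r) = \rank ((B - l%:M) ^+ r).
Proof.
move=> PQ QP PB.
have eN : P *m (B - l%:M) ^+ r = (B1 - l%:M) ^+ r *m P.
  by apply: expmx_intertwine; rewrite mulmxBr mulmxBl PB scalar_mxC.
apply/eqP; rewrite eqn_leq; apply/andP; split.
  rewrite -[X in (\rank X <= _)%N]mulmx1 -PQ mulmxA -eN.
  by apply: leq_trans (mxrankM_maxl _ _) (mxrankM_maxr _ _).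
rewrite -[X in (\rank X <= _)%N]mul1mx -QP -mulmxA eN.
by apply: leq_trans (mxrankM_maxr _ _) (mxrankM_maxl _ _).
Qed.

Lemma signature_circle_congr d e (J B : 'M[C]_d) (J1 B1 : 'M[C]_e) (P : 'M[C]_(e, d)) Q l m :
  skew_unitary J B -> skew_unitary J1 B1 -> l * l^* = 1 ->
  P *m Q = 1%:M -> Q *m P = 1%:M -> P *m B = B1 *m P -> P *m J *m P^t* = J1 ->
  signature (circle_gram J1 B1 l m.+1) = signature (circle_gram J B l m.+1).
Proof.
move=> hJB hJB1 l1 PQ QP PB PJ.
have eN r : P *m (B - l%:M) ^+ r = (B1 - l%:M) ^+ r *m P.
  by apply: expmx_intertwine; rewrite mulmxBr mulmxBl PB scalar_mxC.
have eF : circle_form J1 B1 l m.+1 = P *m circle_form J B l m.+1 *m P^t*.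
  rewrite /circle_form -scalemxAr -scalemxAl; congr (_ *: _).
  by rewrite -PJ !mulmxA -eN -2!mulmxA -trC_mul -eN trC_mul !mulmxA.
have hG := circle_gram_herm hJB m l1; have hG1 := circle_gram_herm hJB1 m l1.
rewrite /circle_gram in hG hG1 *; rewrite eF in hG1 *.
have [K1 eK1] : exists K1, K1 = kermx ((B1 - l%:M) ^+ m.+1) by eexists.
have [K eK] : exists K, K = kermx ((B - l%:M) ^+ m.+1) by eexists.
rewrite -eK -eK1 in hG hG1 *.
have e1 : K1 *m (P *m circle_form J B l m.+1 *m P^t*) *m K1^t* =
   (K1 *m P) *m circle_form J B l m.+1 *m (K1 *m P)^t*.
  by rewrite trC_mul !mulmxA.
rewrite e1 in hG1 *; apply: signature_basis => //.
apply/eqmxP/andP; split.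
  by rewrite eK; apply/sub_kermxP; rewrite -mulmxA eN mulmxA eK1 mulmx_ker mul0mx.
suff /submxP[a ea] : (K *m Q <= K1)%MS.
  by rewrite -[K]mulmx1 -QP mulmxA ea -mulmxA submxMl.
rewrite eK1; apply/sub_kermxP; rewrite -[LHS]mulmx1 -PQ mulmxA -[_ *m _ *m P]mulmxA -eN.
by rewrite -[K *m Q *m _]mulmxA [Q *m _]mulmxA QP mul1mx eK mulmx_ker mul0mx.
Qed.

(** The kernel of a block diagonal matrix is spanned by the blocks' kernels, and in this spanning
    family the Gram matrix is block diagonal. *)
Lemma signature_circle_block p q (J1 B1 : 'M[C]_p) (J2 B2 : 'M[C]_q) l m :
  skew_unitary J1 B1 -> skew_unitary J2 B2 -> l * l^* = 1 ->
  skew_unitary (block_mx J1 0 0 J2) (block_mx B1 0 0 B2) ->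
  signature (circle_gram (block_mx J1 0 0 J2) (block_mx B1 0 0 B2) l m.+1) =
  signature (circle_gram J1 B1 l m.+1) + signature (circle_gram J2 B2 l m.+1).
Proof.
move=> h1 h2 l1 h.
have hG1 := circle_gram_herm h1 m l1; have hG2 := circle_gram_herm h2 m l1.
have hG := circle_gram_herm h m l1.
rewrite -signature_block {1}/circle_gram.
have eK : (kermx ((block_mx B1 0 0 B2 - l%:M) ^+ m.+1) :=:
   block_mx (kermx ((B1 - l%:M) ^+ m.+1)) 0 0 (kermx ((B2 - l%:M) ^+ m.+1)))%MS.
  by rewrite sub_scalar_block expmx_block; apply: kermx_block.
have eG : block_mx (kermx ((B1 - l%:M) ^+ m.+1)) 0 0 (kermx ((B2 - l%:M) ^+ m.+1))
  *m circle_form (block_mx J1 0 0 J2) (block_mx B1 0 0 B2) l m.+1 *m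
  (block_mx (kermx ((B1 - l%:M) ^+ m.+1)) 0 0 (kermx ((B2 - l%:M) ^+ m.+1)))^t* =
  block_mx (circle_gram J1 B1 l m.+1) 0 0 (circle_gram J2 B2 l m.+1).
  rewrite /circle_form sub_scalar_block !expmx_block !tr_block_mx !map_block_mx.
  rewrite !trmx0 !map_mx0 !mulmx_block !(mul0mx, mulmx0, addr0, add0r) scale_block_mx.
  by rewrite !scaler0 !mulmx_block !(mul0mx, mulmx0, addr0, add0r).
rewrite -eG; apply: signature_basis => //; rewrite eG.
by rewrite tr_block_mx map_block_mx !trmx0 !map_mx0 hG1 hG2.
Qed.

End Data.

(** * Classification by induction on the dimension *)

Section Classification.
Variable R : realType.
Let C : numClosedFieldType := R[i].

Lemma symp_block p q (J1 B1 : 'M[R]_p) (J2 B2 : 'M[R]_q) :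
  symp_pair J1 B1 -> symp_pair J2 B2 ->
  symp_pair (block_mx J1 0 0 J2) (block_mx B1 0 0 B2).
Proof.
move=> [h1 u1 e1] [h2 u2 e2]; split.
- by rewrite tr_block_mx !trmx0 h1 h2 opp_block_mx !oppr0.
- by rewrite unitmxE det_ublock unitrM -!unitmxE u1.
- by rewrite tr_block_mx !trmx0 !mulmx_block !(mul0mx, mulmx0, addr0, add0r) e1 e2.
Qed.

Lemma split_rank d e f (B : 'M[R]_d) (B1 : 'M[R]_e) (B2 : 'M[R]_f)
    (P : 'M[R]_(e + f, d)) Q (l : C) r :
  P *m Q = 1%:M -> Q *m P = 1%:M -> P *m B = block_mx B1 0 0 B2 *m P ->
  \rank ((complexify B - l%:M) ^+ r) =
  (\rank ((complexify B1 - l%:M) ^+ r) + \rank ((complexify B2 - l%:M) ^+ r))%N.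
Proof.
move=> PQ QP PB; rewrite -rank_diag_block_mx -expmx_block -sub_scalar_block.
apply/esym; apply: (@rank_shift_congr R _ _ _ _ (complexify P) (complexify Q)).
- by rewrite /complexify -map_mxM PQ map_mx1.
- by rewrite /complexify -map_mxM QP map_mx1.
- have -> : block_mx (complexify B1) 0 0 (complexify B2) = complexify (block_mx B1 0 0 B2).
    by rewrite /complexify map_block_mx !map_mx0.
  by rewrite /complexify -!map_mxM PB.
Qed.

Lemma split_signature d e f (J B : 'M[R]_d) (J1 B1 : 'M[R]_e) (J2 B2 : 'M[R]_f)
    (P : 'M[R]_(e + f, d)) Q (l : C) m :
  symp_pair J B -> symp_pair J1 B1 -> symp_pair J2 B2 -> l * l^* = 1 ->
  P *m Q = 1%:M -> Q *m P = 1%:M -> P *m B = block_mx B1 0 0 B2 *m P ->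
  P *m J *m P^T = block_mx J1 0 0 J2 ->
  signature (circle_gram (complexify J) (complexify B) l m.+1) =
  signature (circle_gram (complexify J1) (complexify B1) l m.+1) +
  signature (circle_gram (complexify J2) (complexify B2) l m.+1).
Proof.
move=> hJB h1 h2 l1 PQ QP PB PJ.
have hb := symp_skew_unitary (symp_block h1 h2).
have cb p q (M : 'M[R]_p) (N : 'M[R]_q) :
    complexify (block_mx M 0 0 N) =
    block_mx (complexify M) 0 0 (complexify N) :> 'M[C]_(p + q).
  by rewrite /complexify map_block_mx !map_mx0.
rewrite !cb in hb.
rewrite -signature_circle_block //; try exact: symp_skew_unitary.
apply/esym; apply: (@signature_circle_congr R _ _ _ _ _ _ (complexify P) (complexify Q)) => //.
- exact: symp_skew_unitary.
- by rewrite /complexify -map_mxM PQ map_mx1.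
- by rewrite /complexify -map_mxM QP map_mx1.
- by rewrite -cb /complexify -!map_mxM PB.
- by rewrite complexify_tr -cb /complexify -!map_mxM PJ.
Qed.

Theorem symp_pair_classification P d d' (J B : 'M[R]_d) (J' B' : 'M[R]_d') :
  adequate P -> symp_pair J B -> symp_pair J' B' ->
  same_data P (complexify J) (complexify B) (complexify J') (complexify B') ->
  exists S : 'M[R]_(d, d'), S *m J' *m S^T = J /\ B *m S = S *m B'.
Proof.
move=> adP; elim: d {-2}d (leqnn d) d' J B J' B' => [|k IH] d dk d' J B J' B' hJB hJB' data.
  have d0 : d = 0%N by apply/eqP; rewrite -leqn0.
  by subst d; exists 0; split; apply/matrixP => -[].
have [d0|dpos] := posnP d.
  by subst d; exists 0; split; apply/matrixP => -[].
have [Z [BZ Zpos]] := exists_positive_hom adP (symp_skew_unitary hJB) (symp_skew_unitary hJB')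
  (complexify_conj J) (complexify_conj B) (complexify_conj J') (complexify_conj B') data dpos.
have [X [BX Xpos]] := real_positive_hom hJB hJB' BZ Zpos.
have [e [K [K' [B1 [e0 KB KB' Ku KK']]]]] := isometric_block hJB hJB' BX Xpos.
have Ku' : K' *m J' *m K'^T \in unitmx by rewrite KK'.
have [f [D [B2 [Q [ef PQ QP PB [h1 [h2 PJ]]]]]]] := orthogonal_split hJB KB Ku.
have [f' [D' [B2' [Q' [ef' PQ' QP' PB' [h1' [h2' PJ']]]]]]] := orthogonal_split hJB' KB' Ku'.
have fk : (f <= k)%N by lia.
have data2 : same_data P (complexify (D *m J *m D^T)) (complexify B2)
    (complexify (D' *m J' *m D'^T)) (complexify B2').
  (* The split summands share [B1] and, by [KK'], the Gram matrix; their contributions cancel from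
     both sides. *)
  have [D1 D2] := data; split=> [l r|l m l1 Plm].
    have := D1 l r.
    by rewrite (split_rank l r PQ QP PB) (split_rank l r PQ' QP' PB') => /addnI.
  have := D2 l m l1 Plm.
  rewrite (split_signature m hJB h1 h2 l1 PQ QP PB PJ).
  by rewrite (split_signature m hJB' h1' h2' l1 PQ' QP' PB' PJ') KK' => /addrI.
have [S2 [SJ SB]] := IH f fk f' _ _ _ _ h2 h2' data2.
set P1 := col_mx K D in PQ QP PB PJ; set P1' := col_mx K' D' in PQ' QP' PB' PJ'.
(* The identity on the split summands and the inductive isometry on their complements; Q M P1'
   rewrites it in the original bases. *)
set M := block_mx 1%:M 0 0 S2 : 'M_(e + f, e + f').
have MJ : M *m (P1' *m J' *m P1'^T) *m M^T = P1 *m J *m P1^T.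
  rewrite PJ PJ' /M tr_block_mx !trmx0 trmx1 !mulmx_block.
  by rewrite !(mul0mx, mulmx0, addr0, add0r, mul1mx, mulmx1) SJ KK'.
have MB : block_mx B1 0 0 B2 *m M = M *m block_mx B1 0 0 B2'.
  by rewrite /M !mulmx_block !(mul0mx, mulmx0, addr0, add0r, mul1mx, mulmx1) SB.
clearbody M P1 P1'; exists (Q *m M *m P1'); split.
  transitivity (Q *m (M *m (P1' *m J' *m P1'^T) *m M^T) *m Q^T).
    by rewrite !trmx_mul !mulmxA.
  rewrite MJ !mulmxA QP mul1mx -mulmxA -trmx_mul QP trmx1 mulmx1 //.
have BQ : B *m Q = Q *m block_mx B1 0 0 B2.
  rewrite -[LHS]mul1mx -QP mulmxA -[Q *m P1 *m B]mulmxA PB -!mulmxA PQ mulmx1 //.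
by rewrite !mulmxA BQ -[_ *m block_mx _ _ _ _ *m M]mulmxA MB -!mulmxA PB'.
Qed.

End Classification.

(** * Symplectic matrices *)

Lemma trmx_expmx (K : comPzRingType) d (N : 'M[K]_d) r : (N ^+ r)^T = N^T ^+ r.
Proof.
elim: r => [|r IH]; first exact: trmx1.
by rewrite expmxSr trmx_mul IH -expmxS.
Qed.

Lemma map_expmx (K L : pzRingType) (f : {rmorphism K -> L}) d (N : 'M[K]_d) r :
  map_mx f (N ^+ r) = map_mx f N ^+ r.
Proof.
elim: r => [|r IH]; first exact: map_mx1.
by rewrite !expmxS map_mxM IH.
Qed.

Lemma eigenvalue_rank (F : fieldType) d (A : 'M[F]_d) a :
  eigenvalue A a = (\rank (A - a%:M)%R < d)%N.
Proof.
rewrite /eigenvalue /eigenspace -mxrank_eq0 mxrank_ker -lt0n subn_gt0.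
by [].
Qed.

Lemma rank_expmx_full (F : fieldType) d (N : 'M[F]_d) r : \rank N = d -> \rank (N ^+ r) = d.
Proof.
move=> rN; elim: r => [|r IH]; first exact: mxrank1.
by rewrite expmxSr mxrankMfree // /row_free rN.
Qed.

Lemma colkerE (F : fieldType) d (M : 'M[F]_d) r : colker M r = kermx (M^T ^+ r).
Proof. by rewrite /colker trmx_expmx. Qed.

Lemma rank_colker (F : fieldType) d (M N : 'M[F]_d) r :
  \rank (colker M r) = \rank (colker N r) -> \rank (M ^+ r) = \rank (N ^+ r).
Proof.
rewrite !mxrank_ker !mxrank_tr.
by have := rank_leq_row (M ^+ r); have := rank_leq_row (N ^+ r); lia.
Qed.

Lemma omega0_tr (K : pzRingType) n : (Omega0 K n)^T = - Omega0 K n.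
Proof.
by rewrite tr_block_mx opp_block_mx !trmx0 !linearN /= trmx1 !oppr0 opprK.
Qed.

Lemma omega0_unit (F : fieldType) n : Omega0 F n \in unitmx.
Proof.
have : Omega0 F n *m - Omega0 F n = 1%:M.
  rewrite mulmxN mulmx_block !(mul0mx, mulmx0, mul1mx, mulmx1, addr0, add0r).
  by rewrite opp_block_mx !oppr0 opprK -scalar_mx_block.
by case/mulmx1_unit.
Qed.

Lemma map_omega0 (K L : pzRingType) (f : {rmorphism K -> L}) n :
  map_mx f (Omega0 K n) = Omega0 L n.
Proof. by rewrite map_block_mx !map_mx0 map_mxN map_mx1. Qed.

Lemma symplectic_pair (F : fieldType) n (A : 'M[F]_(n + n)) : symplectic A ->
  symp_pair (Omega0 F n) A^T.
Proof.
move=> /eqP h; split; [exact: omega0_tr|exact: omega0_unit|by rewrite trmxK].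
Qed.

(** The map [f] is the identity for the real forms and conjugation for the Hermitian ones. *)
Lemma gram_formE (F : fieldType) d (M : 'M[F]_d) m Q (G : 'M[F]_d) (f : {rmorphism F -> F}) :
  (forall x y : 'rV_d, Q x^T y^T = (x *m G *m map_mx f y^T) 0 0) ->
  gram M m Q = row_base (colker M m) *m G *m map_mx f (row_base (colker M m))^T.
Proof.
move=> h; apply/matrixP => i j; rewrite mxE h; move: (row_base _) => K.
rewrite -row_mul [LHS]mxE [RHS]mxE; apply: eq_bigr => k _.
by rewrite [row _ _ _ _]mxE; congr (_ * _); rewrite !mxE.
Qed.

Section Symmetries.
Variable R : realType.
Let C : numClosedFieldType := R[i].

Lemma rank_shift_conj d (B : 'M[R]_d) (l : C) r :
  \rank ((complexify B - (l^*)%:M) ^+ r) = \rank ((complexify B - l%:M) ^+ r).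
Proof.
rewrite -(mxrank_map Num.conj ((complexify B - l%:M) ^+ r)) map_expmx map_mxB.
by rewrite complexify_conj map_scalar_mx.
Qed.

(** The shift at l crosses [J] as a multiple of the shift at 1/conj l. Since l -> 1/conj l is an
    involution, this inequality yields equality. *)
Lemma rank_shift_inv_le (F : numClosedFieldType) d (J B : 'M[F]_d) (l : F) r :
  skew_unitary J B -> l != 0 ->
  (\rank ((B - l%:M) ^+ r) <= \rank ((B - ((l^*)^-1)%:M) ^+ r))%N.
Proof.
move=> h l0; have e := skew_unitary_shiftX h r l0.
have [Q eQ] := shift_factor (- l^*) ((l^*)^-1) r (skew_unitary_mulV h).
rewrite eQ in e; have [_ Ju _] := h.
rewrite -[X in (X <= _)%N]mxrank_tr -(mxrank_map Num.conj (_)^T).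
have -> : \rank (((B - l%:M) ^+ r)^t*) = \rank (J *m ((B - l%:M) ^+ r)^t*).
  by rewrite -[RHS]mxrank_tr trmx_mul mxrankMfree ?mxrank_tr // row_free_unit unitmx_tr.
rewrite e; apply: leq_trans (mxrankM_maxl _ _) _; exact: mxrankM_maxr.
Qed.

Lemma rank_shift_inv d (J B : 'M[R]_d) (l : C) r : symp_pair J B -> l != 0 ->
  \rank ((complexify B - ((l^*)^-1)%:M) ^+ r) = \rank ((complexify B - l%:M) ^+ r).
Proof.
move=> /symp_skew_unitary h l0; apply/eqP.
rewrite eqn_leq (rank_shift_inv_le r h l0) andbT.
have mu0 : (l^*)^-1 != 0 by rewrite invr_eq0 conjC_eq0.
have := rank_shift_inv_le r h mu0.
by rewrite fmorphV /= conjCK invrK.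
Qed.

Lemma rank_eigen_class d (J B : 'M[R]_d) (l mu : C) r : symp_pair J B -> l != 0 ->
  mu \in eigen_class l ->
  \rank ((complexify B - mu%:M) ^+ r) = \rank ((complexify B - l%:M) ^+ r).
Proof.
move=> h l0; rewrite !inE => /or4P[] /eqP-> //.
- rewrite -(rank_shift_inv r h) ?invr_eq0 // fmorphV invrK.
  exact: rank_shift_conj.
- exact: rank_shift_conj.
- exact: (rank_shift_inv r h).
Qed.

Lemma complexify_shiftX d (A : 'M[R]_d) (l : C) r :
  ((complexify A - l%:M) ^+ r)^T = (complexify A^T - l%:M) ^+ r.
Proof.
by rewrite trmx_expmx linearB /= tr_scalar_mx /complexify map_trmx.
Qed.

Lemma signature_circle_basis p d (J B : 'M[C]_d) (K : 'M[C]_(p, d)) (l : C) m :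
  skew_unitary J B -> l * l^* = 1 -> (K :=: kermx ((B - l%:M) ^+ m.+1))%MS ->
  signature (K *m circle_form J B l m.+1 *m K^t*) =
  signature (circle_gram J B l m.+1).
Proof.
move=> h l1 eK; have RK : K *m (B - l%:M) ^+ m.+1 = 0 by apply/sub_kermxP; rewrite eK.
rewrite /circle_gram; apply: signature_basis => //; last exact: (circle_gram_herm h m l1).
by rewrite (top_circle_form h l1 RK) -scalemxAl (circle_form_top_herm h l1 RK).
Qed.

Lemma Omega_shift n (A : 'M[R]_(n + n)) (l : C) a b (x : 'rV[C]_(n + n)) (w : 'cV[C]_(n + n)) :
  Omega ((complexify A - l%:M) ^+ a *m x^T) ((complexify A - (conjc l)%:M) ^+ b *m w) =
  (x *m ((complexify A^T - l%:M) ^+ a *m complexify (Omega0 R n) *m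
    ((complexify A^T - l%:M) ^+ b)^t*) *m w) 0 0.
Proof.
rewrite /Omega trmx_mul trmxK (complexify_shiftX A l a) -(complexify_shiftX A l b) trmxK.
rewrite map_expmx map_mxB complexify_conj map_scalar_mx.
by rewrite [complexify (Omega0 R n)]map_omega0 !mulmxA.
Qed.

Lemma Qherm_form n (A : 'M[R]_(n + n)) (l : C) m (x y : 'rV[C]_(n + n)) :
  Qherm A l m.+1 x^T y^T =
  (x *m circle_form (complexify (Omega0 R n)) (complexify A^T) l m.+1 *m
     map_mx Num.conj y^T) 0 0.
Proof.
rewrite /Qherm /circle_form /form_coef -scalemxAr -scalemxAl mxE !Omega_shift.
(* At index m + 1 the second exponent is m/2 rounded down: k if m + 1 = 2k + 1, and k - 1 if m + 1 =
   2k. *)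
have h : m.+1.-1./2 = if odd m.+1 then m.+1./2 else m.+1./2.-1.
  by rewrite -[m.+1./2]/(uphalf m) uphalf_half /=; case: odd.
by rewrite h; case: (odd m.+1).
Qed.

Lemma signature_gram_herm n (A : 'M[R]_(n + n)) (l : C) m : symplectic A ->
  l * l^* = 1 ->
  signature (gram_herm A l m.+1) =
  signature (circle_gram (complexify (Omega0 R n)) (complexify A^T) l m.+1).
Proof.
move=> sA l1; have h := symp_skew_unitary (symplectic_pair sA).
rewrite /gram_herm (gram_formE _ _ (Qherm_form A l m)).
have eK : colker (complexify A - l%:M) m.+1 = kermx ((complexify A^T - l%:M) ^+ m.+1).
  by rewrite colkerE -trmx_expmx complexify_shiftX.
by rewrite (signature_circle_basis h l1) // -eK; apply: eq_row_base.
Qed.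

Lemma Qreal_form n (A : 'M[R]_(n + n)) (e : R) k (x y : 'rV[R]_(n + n)) :
  Qreal A e k x^T y^T =
  (x *m (e *: ((A^T - e%:M) ^+ k *m Omega0 R n *m ((A^T - e%:M) ^+ k.-1)^T)) *m
     map_mx idfun y^T) 0 0.
Proof.
rewrite /Qreal /Omega -scalemxAr -scalemxAl [RHS]mxE; congr (_ * _).
have eT r : (A^T - e%:M) ^+ r = ((A - e%:M) ^+ r)^T.
  by rewrite trmx_expmx linearB /= tr_scalar_mx.
by rewrite !eT trmxK trmx_mul trmxK map_mx_id // !mulmxA.
Qed.

(** The complexified real kernel is the complex kernel, and e = 1/e identifies the prefactor of the
    real form with that of the Hermitian form of even index. *)
Lemma signature_gram_real n (A : 'M[R]_(n + n)) (e : R) k m : symplectic A ->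
  e = 1 \/ e = -1 -> (2 * k = m.+1)%N ->
  signature (complexify (gram_real A e k)) =
  signature (circle_gram (complexify (Omega0 R n)) (complexify A^T) (e%:C%C : C) m.+1).
Proof.
move=> sA e1 km; have h := symp_skew_unitary (symplectic_pair sA).
have ee : e * e = 1 by case: e1 => ->; rewrite ?mulrNN mulr1.
have l1 : (e%:C%C : C) * (e%:C%C)^* = 1.
  by rewrite [_^*]conjc_real -rmorphM ee rmorph1.
have eK : complexify (colker (A - e%:M) (2 * k)) =
    kermx ((complexify A^T - (e%:C%C)%:M) ^+ m.+1) :> 'M[C]_(n + n).
  rewrite colkerE /complexify map_kermx map_expmx km linearB /= map_mxB tr_scalar_mx.
  by rewrite map_scalar_mx.
rewrite /gram_real (gram_formE _ _ (Qreal_form A e k)).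
set RB := row_base _; have eR : (RB :=: colker (A - e%:M) (2 * k))%MS := eq_row_base _.
clearbody RB; rewrite map_mx_id //; set G := _ *: _.
have eG : complexify G =
   circle_form (complexify (Omega0 R n)) (complexify A^T) (e%:C%C : C) m.+1.
  rewrite /circle_form /form_coef /complexify /G map_mxZ !map_mxM -km mul2n odd_double doubleK.
  have -> : k.*2.-1./2 = k.-1 by lia.
  have <- : e%:C%C = (e%:C%C)^-1 :> C.
    by rewrite -fmorphV -[e^-1]mul1r -ee mulfK //; case: e1 => ->; rewrite ?oppr_eq0 oner_eq0.
  have mapN r : map_mx (real_complex R) ((A^T - e%:M) ^+ r) =
      (complexify A^T - (e%:C%C)%:M) ^+ r.
    by rewrite map_expmx map_mxB map_scalar_mx.
  by rewrite -!mapN -[in RHS]/(complexify _) complexify_tr.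
have eRK : ((complexify RB : 'M[C]_(_, _)) :=:
    kermx ((complexify A^T - (e%:C%C)%:M) ^+ m.+1))%MS.
  by rewrite -eK; apply/eqmxP; rewrite !map_submx !eR !submx_refl.
have -> : complexify (RB *m G *m RB^T) =
    complexify RB *m complexify G *m (complexify RB)^t* :> 'M[C]_(_, _).
  by rewrite complexify_tr /complexify !map_mxM.
by rewrite eG (signature_circle_basis h l1 eRK).
Qed.

End Symmetries.

(** * Reduction of the theorem to the classification *)

Section Reduction.
Variables (R : realType) (n : nat).
Let C : numClosedFieldType := R[i].
Implicit Types A B : 'M[R]_(n + n).

Lemma rank_complexify_tr A (l : C) r :
  \rank ((complexify A^T - l%:M) ^+ r) = \rank ((complexify A - l%:M) ^+ r).
Proof. by rewrite -complexify_shiftX mxrank_tr. Qed.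

Lemma rank_symplectic_class A (l mu : C) r : symplectic A -> l != 0 ->
  mu \in eigen_class l ->
  \rank ((complexify A - mu%:M) ^+ r) = \rank ((complexify A - l%:M) ^+ r).
Proof.
move=> sA l0 lm; rewrite -(rank_complexify_tr A mu) -(rank_complexify_tr A l).
exact: (rank_eigen_class r (symplectic_pair sA) l0 lm).
Qed.

Lemma symplectic_eigenvalue_neq0 A (l : C) : symplectic A ->
  eigenvalue (complexify A) l -> l != 0.
Proof.
move=> sA ev; apply: contraTneq ev => ->; rewrite eigenvalue_rank -leqNgt.
have := skew_unitary_unit (symp_skew_unitary (symplectic_pair sA)).
rewrite raddf0 subr0 -row_full_unit /row_full -(mxrank_tr (complexify A)).
by rewrite /complexify map_trmx => /eqP->.
Qed.

Lemma eigenvalue_class A (l mu : C) : symplectic A ->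
  eigenvalue (complexify A) l -> mu \in eigen_class l -> eigenvalue (complexify A) mu.
Proof.
move=> sA ev lm; have l0 := symplectic_eigenvalue_neq0 sA ev; move: ev.
rewrite !eigenvalue_rank -[_ - l%:M]expr1 -[_ - mu%:M]expr1.
by rewrite (rank_symplectic_class _ sA l0 lm).
Qed.

Lemma rank_complexify_real A (e : R) r :
  \rank ((complexify A - (e%:C%C)%:M) ^+ r) = \rank ((A - e%:M) ^+ r).
Proof.
by rewrite -(mxrank_map (real_complex R)) map_expmx map_mxB map_scalar_mx.
Qed.

Lemma eigenvalue_complexify A (e : R) :
  eigenvalue (complexify A) e%:C%C = eigenvalue A e.
Proof.
by rewrite !eigenvalue_rank -[_ - _%:M]expr1 rank_complexify_real expr1.
Qed.

Lemma circle_gram_eq0 d (J B : 'M[C]_d) (l : C) m :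
  \rank (B - l%:M) = d -> circle_gram J B l m = 0.
Proof.
move=> rB; rewrite /circle_gram; suff -> : kermx ((B - l%:M) ^+ m) = 0 by rewrite !mul0mx.
by apply/eqP; rewrite kermx_eq0 /row_free rank_expmx_full.
Qed.

Lemma circle_gram_not_eigenvalue A (l : C) m : ~~ eigenvalue (complexify A) l ->
  circle_gram (complexify (Omega0 R n)) (complexify A^T) l m = 0.
Proof.
rewrite eigenvalue_rank -leqNgt => rA; apply: circle_gram_eq0.
apply/eqP; rewrite eqn_leq rank_leq_row /=.
by rewrite -[_ - l%:M]expr1 rank_complexify_tr expr1.
Qed.

Lemma unit_circle_real (l : C) : l * l^* = 1 -> l^* = l -> l = 1 \/ l = -1.
Proof.
move=> l1 lR; rewrite lR in l1.
have : (l - 1) * (l + 1) == 0 by rewrite -subr_sqr expr2 l1 expr1n subrr.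
rewrite mulf_eq0 subr_eq0 addr_eq0 => /orP[] /eqP; by [left|right].
Qed.

(* The signatures that the hypotheses of the theorem control. *)
Definition tested A (rep : C -> C) (l : C) m : Prop :=
  ((l = 1 \/ l = -1) /\ ~~ odd m) \/
  [/\ l != 1, l != -1 & eigenvalue (complexify A) l -> rep l = l].

(** On the circle the class of l consists of l and its conjugate, so the common representative of
    both is one of them. If l is not an eigenvalue, the condition on [rep] is vacuous. *)
Lemma tested_adequate A rep : symplectic A -> class_representatives A rep ->
  adequate (tested A rep).
Proof.
move=> sA crep l l1; have lV := circle_conjV l1; split=> [lR m om|lR].
  by left; split; [exact: unit_circle_real|rewrite /= negbK].
have [n1 n2] : l != 1 /\ l != -1.
  by split; apply: contraNneq lR => ->; rewrite ?rmorphN rmorph1.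
have [n1' n2'] : l^* != 1 /\ l^* != -1.
  by split; rewrite -(inj_eq (can_inj conjCK)) conjCK ?rmorphN rmorph1.
have [ev|nev] := boolP (eigenvalue (complexify A) l); last first.
  by left=> m; right; split=> // ev; rewrite ev in nev.
have [rin req] := crep l ev.
have [e|ne] := eqVneq (rep l) l; first by left=> m; right.
right=> m; right; split=> // _.
have lin : l^* \in eigen_class l by rewrite !inE eqxx !orbT.
rewrite (req _ lin); move: rin; rewrite !inE (negbTE ne) /= -lV.
have -> : (conjc l)^-1 = l by rewrite -[conjc l]/(l^*) lV invrK.
by rewrite (negbTE ne) orbF -[conjc l]/(l^*) orbb => /eqP.
Qed.

End Reduction.

Theorem theorem2 (R : realType) (n : nat) :
  (forall (A : 'M[R]_(n + n)) (l mu : R[i]),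
     symplectic A -> eigenvalue (complexify A) l ->
     mu \in eigen_class l -> eigenvalue (complexify A) mu)
  /\
  (forall (A B : 'M[R]_(n + n)) (rep : R[i] -> R[i]),
     symplectic A -> symplectic B ->
     (forall l : R[i],
        eigenvalue (complexify A) l = eigenvalue (complexify B) l) ->
     class_representatives A rep ->
     (forall (l : R[i]) (r : nat),
        eigenvalue (complexify A) l -> l != 1 -> l != -1 -> (0 < r)%N ->
        \rank (colker (complexify A - (rep l)%:M) r)
        = \rank (colker (complexify B - (rep l)%:M) r)) ->
     (forall (e : R) (r : nat),
        eigenvalue A e -> e = 1 \/ e = -1 -> (0 < r)%N ->
        \rank (colker (A - e%:M) r) = \rank (colker (B - e%:M) r)) ->
     (forall (e : R) (k : nat),
        eigenvalue A e -> e = 1 \/ e = -1 -> (0 < k)%N ->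
        \rank (gram_real A e k) = \rank (gram_real B e k) /\
        signature (complexify (gram_real A e k))
        = signature (complexify (gram_real B e k))) ->
     (forall (l : R[i]) (m : nat),
        eigenvalue (complexify A) l -> `|l| = 1 -> l != 1 -> l != -1 ->
        (0 < m)%N ->
        \rank (gram_herm A (rep l) m) = \rank (gram_herm B (rep l) m) /\
        signature (gram_herm A (rep l) m)
        = signature (gram_herm B (rep l) m)) ->
     exists S : 'M[R]_(n + n),
       symplectic S /\ S *m A *m invmx S = B).
Proof.
split=> [A l mu sA|A B rep sA sB evAB crep rk rkR sgR sgH].
  exact: eigenvalue_class.
have real_pm (l : R[i]) : l = 1 \/ l = -1 ->
    exists e : R, l = real_complex R e /\ (e = 1 \/ e = -1).
  by case=> ->; [exists 1|exists (-1)]; rewrite ?rmorphN rmorph1; split=> //; [left|right].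
have data : same_data (tested A rep) (complexify (Omega0 R n)) (complexify A^T)
    (complexify (Omega0 R n)) (complexify B^T).
  split=> [l r|l m l1].
    rewrite !rank_complexify_tr.
    have [ev|nev] := boolP (eigenvalue (complexify A) l); last first.
      have nev' := nev; rewrite evAB in nev'.
      have full (M : 'M[R]_(n + n)) : ~~ eigenvalue (complexify M) l ->
          \rank (complexify M - l%:M) = (n + n)%N.
        rewrite eigenvalue_rank -leqNgt => h.
        by apply/anti_leq/andP; split; [exact: rank_leq_row|].
      by rewrite !rank_expmx_full // full.
    case: r => [|r]; first by rewrite !expr0.
    have [[e [le e1]]|[n1 n2]] : (exists e : R, l = real_complex R e /\ (e = 1 \/ e = -1)) \/
        l != 1 /\ l != -1.
      have [->|n1] := eqVneq l 1; first by left; apply: real_pm; left.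
      have [->|n2] := eqVneq l (-1); first by left; apply: real_pm; right.
      by right.
      rewrite le !rank_complexify_real; apply/rank_colker/rkR => //.
      by rewrite -eigenvalue_complexify -le.
    have l0 := symplectic_eigenvalue_neq0 sA ev.
    have [rin _] := crep l ev.
    (* The ranks are given only at [rep l]; symmetry within the class carries them to l. *)
    rewrite -(rank_symplectic_class r.+1 sA l0 rin) -(rank_symplectic_class r.+1 sB l0 rin).
    exact/rank_colker/rk.
  have [ev|nev] := boolP (eigenvalue (complexify A) l); last first.
    have nev' := nev; rewrite evAB in nev'.
    by rewrite !circle_gram_not_eigenvalue.
  case=> [[/real_pm[e [le e1]] om]|[n1 n2 /(_ ev) repl]].
    have km : (2 * (m.+1)./2 = m.+1)%N by rewrite mul2n even_halfK.
    rewrite le; apply: etrans (esym (signature_gram_real sA e1 km)) _.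
    apply: etrans (signature_gram_real sB e1 km).
    apply sgR => //; last by lia.
    by rewrite -eigenvalue_complexify -le.
  apply: etrans (esym (signature_gram_herm m sA l1)) _.
  apply: etrans (signature_gram_herm m sB l1); rewrite -repl.
  apply sgH => //.
  by apply/eqP; rewrite -(eqrXn2 (n := 2)) ?normr_ge0 // expr1n normCK l1.
have [S [SJ SB]] := symp_pair_classification (tested_adequate sA crep)
  (symplectic_pair sA) (symplectic_pair sB) data.
(* The isometry S acts on rows and intertwines A^T with B^T, so its transpose is the conjugating
   matrix. *)
have Su : S^T \in unitmx.
  rewrite unitmx_tr.
  have : S *m (Omega0 R n *m S^T *m invmx (Omega0 R n)) = 1%:M.
    by rewrite !mulmxA SJ mulmxV // omega0_unit.
  by case/mulmx1_unit.
exists S^T; split; first by rewrite /symplectic trmxK SJ.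
have -> : S^T *m A = B *m S^T by apply: trmx_inj; rewrite !trmx_mul trmxK SB.
by rewrite mulmxK.
Qed.
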